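(* Let $(\Omega,\mathcal F,\mathbb P)$ be an atomless probability space, let $p\in(0,1)$ and let $\rho:L^\infty\to\mathbb R$ be a risk measure. Then $\rho$ satisfies [M], [TI], [P], [$p$-CA] and $\rho(0)=0$ if and only if $\rho=\mathrm{ES}_p$ on $L^\infty$.
   Context: $(\Omega,\mathcal F,\mathbb P)$ is atomless; $L^\infty$ is the space of essentially bounded random variables. A risk measure is simply a functional on this space. $X\overset{d}{=}Y$ means equality in law. For $p\in(0,1)$, $\mathrm{VaR}_p(X)=\inf\{x\in\mathbb R:\mathbb P(X\le x)\ge p\}$ and $\mathrm{ES}_p(X)=\frac1{1-p}\int_p^1\mathrm{VaR}_s(X)\,ds$. A tail event of a random variable $X$ is an event $A\in\mathcal F$ with $0<\mathbb P(A)<1$ such that $X(\omega)\ge X(\omega')$ for a.s. all $\omega\in A$ and $\omega'\in A^c$. A $p$-tail event of $X$ is a tail event of $X$ with probability $1-p$. A random vector is $p$-concentrated if its components share a common $p$-tail event. [M]: $\rho(X)\le\rho(Y)$ whenever $X\le Y$ pointwise. [TI]: $\rho(X+c)=\rho(X)+c$ for all $X$ and all $c\in\mathbb R$. [P] (lower semicontinuity): $\liminf_{n\to\infty}\rho(X_n)\ge\rho(X)$ whenever $X,X_1,X_2,\dots\in L^\infty$ and $X_n\to X$ pointwise (no uniform bound on the sequence is required). [$p$-CA]: $\rho(X+Y)\le\rho(X'+Y')$ for all $X,Y,X',Y'\in L^\infty$ such that $(X',Y')$ is $p$-concentrated, $X\overset{d}{=}X'$ and $Y\overset{d}{=}Y'$.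 *)

(* Defs.v *)
From HB Require Import structures.
From mathcomp Require Import all_boot all_order all_algebra.
From mathcomp Require Import all_classical all_reals all_analysis.
From mathcomp Require Import ess_sup_inf hoelder random_variable.

Set Implicit Arguments.
Unset Strict Implicit.
Unset Printing Implicit Defensive.

Import Order.TTheory GRing.Theory Num.Theory.
Import numFieldNormedType.Exports.

Local Open Scope classical_set_scope.
Local Open Scope ring_scope.

(* Random variables, not classes modulo a.s. equality: pointwise comparison and
   pointwise convergence are therefore meaningful on this type. *)
Notation Linfty P := (LfunType P (leey 1%E)).

Section risk_measures.
Context (d : measure_display) (T : measurableType d) (R : realType).
Variable P : probability T R.

Definition atomless : Prop :=
  forall A : set T, measurable A -> (0 < P A)%E ->
    exists B : set T, [/\ measurable B, B `<=` A, (0 < P B)%E & (P B < P A)%E].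

Lemma Linfty_cst_subproof (c : R) : (cst c : T -> R) \in Lfun P +oo%E.
Proof.
rewrite inE; apply/andP; split; rewrite inE/=; first exact: measurable_cst.
rewrite /finite_norm unlock /Lnorm; case: ifPn => // P0.
by rewrite (ess_sup_ae_cst `|c|%:E P0) ?ltry//; exact: nearW.
Qed.

Definition Linfty_cst (c : R) : Linfty P :=
  Lfun_Sub (leey 1%E) (Linfty_cst_subproof c).

Definition eq_law (X Y : {RV P >-> R}) : Prop :=
  forall B : set R, measurable B -> distribution P X B = distribution P Y B.

Definition VaR (s : R) (X : {RV P >-> R}) : R :=
  inf [set x : R | (s%:E <= cdf X x)%E].

Definition ES (p : R) (X : {RV P >-> R}) : R :=
  (1 - p)^-1 * \int[lebesgue_measure]_(s in `]p, 1[) VaR s X.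

Definition tail_event (X : {RV P >-> R}) (A : set T) : Prop :=
  [/\ measurable A, (0 < P A)%E, (P A < 1)%E &
      \forall w \ae P, A w -> \forall w' \ae P, ~ A w' -> X w' <= X w].

Definition p_tail_event (p : R) (X : {RV P >-> R}) (A : set T) : Prop :=
  tail_event X A /\ P A = (1 - p)%:E.

Definition p_concentrated (p : R) (X Y : {RV P >-> R}) : Prop :=
  exists A : set T, p_tail_event p X A /\ p_tail_event p Y A.

Definition monotone_risk (rho : Linfty P -> R) : Prop :=
  forall X Y : Linfty P, (forall w, X w <= Y w) -> rho X <= rho Y.

Definition translation_invariant (rho : Linfty P -> R) : Prop :=
  forall (X : Linfty P) (c : R), rho (X + Linfty_cst c) = rho X + c.

(* The lower limit is taken in the extended reals, since it may be infinite. *)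
Definition pointwise_lsc (rho : Linfty P -> R) : Prop :=
  forall (X : Linfty P) (Xn : nat -> Linfty P),
    (forall w, Xn n w @[n --> \oo] --> X w) ->
    ((rho X)%:E <= limn_einf (fun n => (rho (Xn n))%:E))%E.

Definition p_concentration_averse (p : R) (rho : Linfty P -> R) : Prop :=
  forall X Y X' Y' : Linfty P,
    p_concentrated p X' Y' -> eq_law X X' -> eq_law Y Y' ->
    rho (X + Y) <= rho (X' + Y').

End risk_measures.

Arguments VaR {d T R} P s X.
Arguments ES {d T R} P p X.
Arguments eq_law {d T R} P X Y.
Arguments tail_event {d T R} P X A.
Arguments p_tail_event {d T R} P p X A.
Arguments p_concentrated {d T R} P p X Y.

(* Main.v *)
Require Import Defs.
From HB Require Import structures.
From mathcomp Require Import all_boot all_order all_algebra.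
From mathcomp Require Import all_classical all_reals all_analysis.
From mathcomp Require Import ess_sup_inf hoelder random_variable.
From mathcomp Require Import measurable_realfun ring lra.

Set Implicit Arguments.
Unset Strict Implicit.
Unset Printing Implicit Defensive.

Import Order.TTheory GRing.Theory Num.Theory.
Import numFieldNormedType.Exports.

Local Open Scope classical_set_scope.
Local Open Scope ring_scope.

(* Uniqueness: concentration aversion makes [rho] law invariant and lets one replace
   the summands of [X = X/N + ... + X/N] one by one by copies with the same law and
   the same [p]-tail event [A].  If [X] takes N equiprobable values on [A] and N
   equiprobable smaller values on its complement, cyclic shifts of these values show
   that [rho X] only depends on the mean [a] of [X] on [A] and its mean on the
   complement.  The latter is irrelevant: losses on sets shrinking to the empty set
   can keep a fixed mean while converging pointwise to 0, so lower semicontinuity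
   (without uniform bounds) and translation invariance give [rho X = a].  A general
   [X] has the law of [q(U)], for its quantile function [q] and a uniform [U], and is
   squeezed between such step variables.
   Existence: [(1 - p) (ES_p X - x) <= E (X - x)^+], with equality at [x = VaR_p X];
   this yields subadditivity, and additivity for a common tail event.  The lower
   semicontinuity is that of [VaR_s] for [s > p], followed by Fatou's lemma, in which
   [VaR_p] provides the lower bound. *)

(** * A uniform random variable on an atomless probability space *)

Section uniform_variable.
Context (d : measure_display) (T : measurableType d) (R : realType).
Variable P : probability T R.

(* Without injectivity of [P], the union of the members of a chain below a given
   level could be an uncountable union of sets differing by null sets. *)
Definition strict_chain (F : set (set T)) : Prop :=
  F `<=` measurable /\ forall C D, F C -> F D ->
    (C `<=` D \/ D `<=` C) /\ (P C = P D -> C = D).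

Definition maximal_strict_chain (F : set (set T)) : Prop :=
  strict_chain F /\ forall G, F `<` G -> ~ strict_chain G.

Lemma maximal_strict_chain_exists : exists F, maximal_strict_chain F.
Proof.
apply: Zorn_bigcup => F Fs Ftot; split.
  by move=> A [X FX XA]; exact: (Fs X FX).1.
move=> C D [X FX XC] [Y FY YD].
have [XY|YX] := Ftot X Y FX FY.
- by apply: (Fs Y FY).2 => //; exact: XY.
- by apply: (Fs X FX).2 => //; exact: YX.
Qed.

(** In the case [D] included in [C] the two measures coincide, and injectivity of [P] on the chain
    identifies the sets. *)
Lemma strict_chain_le F C D : strict_chain F -> F C -> F D ->
  (P C <= P D)%E -> C `<=` D.
Proof.
move=> [mF cF] FC FD CD.
have [[//|DC] inj] := cF C D FC FD.
have DCP : (P D <= P C)%E by apply: le_measure => //; rewrite inE; exact: mF.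
by rewrite (inj _)//; apply/eqP; rewrite eq_le CD.
Qed.

(** Otherwise adding [E] would give a strictly larger strict chain. Maximality is always used in
    this form below. *)
Lemma maximal_insert F E : maximal_strict_chain F -> measurable E ->
  (forall D, F D -> (D `<=` E \/ E `<=` D) /\ P D != P E) -> F E.
Proof.
move=> [[mF cF] maxF] mE cE; apply: contrapT => FE.
apply: (maxF (F `|` [set E])).
  split; first exact: subsetUl.
  by move/(_ E (or_intror erefl)).
split; first by move=> A [/mF//|->].
move=> C D [FC|->] [FD|->].
- exact: cF.
- have [h n] := cE C FC; split => //.
  by move=> e; rewrite e eqxx in n.
- have [h n] := cE D FD; split; first by case: h; [right|left].
  by move=> e; rewrite e eqxx in n.
- by split => //; left.
Qed.

(** Complementation turns a largest member below a level into a smallest member above the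
    complementary level, so only one of the two has to be constructed. *)
Lemma strict_chainC F : strict_chain F -> strict_chain (setC @^-1` F).
Proof.
move=> [mF cF]; split.
  by move=> A /= /mF/measurableC; rewrite setCK.
move=> C D /= FC FD; have [h inj] := cF _ _ FC FD; split.
  by case: h => /subsetC; rewrite !setCK; [right|left].
move=> CD; apply: (can_inj setCK); apply: inj.
rewrite !probability_setC ?CD//.
  by rewrite -(setCK D); exact/measurableC/mF.
by rewrite -(setCK C); exact/measurableC/mF.
Qed.

Lemma maximal_strict_chainC F : maximal_strict_chain F ->
  maximal_strict_chain (setC @^-1` F).
Proof.
move=> [sF maxF]; split; first exact: strict_chainC.
move=> G [FG nGF] /strict_chainC; apply: maxF; split.
  by move=> A FA /=; apply: FG; rewrite /= setCK.
by move=> GF; apply: nGF => A GA /=; apply: GF; rewrite /= setCK.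
Qed.

(** If the supremum [a] of the measures not exceeding [t] were not attained, the union of a sequence
    of members with measures tending to [a] would have measure [a] and be comparable with every
    member; by maximality it would belong to the chain. *)
Lemma maximal_strict_chain_below F (t : R) : maximal_strict_chain F -> 0 <= t ->
  exists C, [/\ F C, (P C <= t%:E)%E &
    forall D, F D -> (P D <= t%:E)%E -> (P D <= P C)%E].
Proof.
move=> maxF t0; have [sF _] := maxF; have [mF cF] := sF.
apply: contrapT => nC.
pose A := [set C | F C /\ (P C <= t%:E)%E].
have natt C : A C -> exists D, A D /\ (P C < P D)%E.
  move=> [FC Ct]; apply: contrapT => h; apply: nC; exists C; split => //.
  move=> D FD Dt; rewrite leNgt; apply/negP => CD.
  by apply: h; exists D.
(* If every member had measure above [t], the empty set could be inserted. *)
have A0 : A !=set0.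
  apply: contrapT => An; have FE : F set0.
    apply: maximal_insert => // D FD; split; first by right; exact: sub0set.
    rewrite measure0 gt_eqF// ltNge; apply/negP => D0; apply: An; exists D.
    by split => //; rewrite (le_trans D0)// lee_fin.
  by apply: An; exists set0; split => //; rewrite measure0 lee_fin.
pose a := ereal_sup [set P C | C in A].
have ub C : A C -> (P C <= a)%E by move=> AC; apply: ereal_sup_ubound; exists C.
have ltA C : A C -> (P C < a)%E.
  by move=> /natt[D [/ub DA CD]]; exact: lt_le_trans DA.
have at_ : (a <= t%:E)%E by apply: ge_ereal_sup => _ [C [_ Ct] <-].
have afin : a \is a fin_num.
  apply/fin_numPlt/andP; split; last exact: le_lt_trans at_ (ltry _).
  by case: A0 => C /ub; apply: lt_le_trans; apply: lt_le_trans (measure_ge0 _ _).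
have seqC n : {C | A C /\ (a - (n.+1%:R^-1)%:E < P C)%E}.
  apply: cid.
  have n0 : (0 < (n.+1%:R^-1 : R)) by rewrite invr_gt0.
  have [_ [C AC <-] Cn] := ub_ereal_sup_adherent n0 afin.
  by exists C.
pose C n := sval (seqC n).
have AC n : A (C n) := (svalP (seqC n)).1.
have aC n : (a - (n.+1%:R^-1)%:E < P (C n))%E := (svalP (seqC n)).2.
(* Finite unions make the sequence increasing; in a chain each of them is again one of the [C i]. *)
pose D n := \big[setU/set0]_(i < n.+1) C i.
have AD n : A (D n).
  elim: n => [|n ih]; first by rewrite /D big_ord_recr big_ord0/= set0U.
  rewrite /D big_ord_recr/= -/(D n).
  have [[/setUidPr->|/setUidPl->] _] := cF _ _ ih.1 (AC n.+1).1; last by [].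
  exact: AC.
pose E := \bigcup_n D n.
have mD n : measurable (D n) by apply: mF; exact: (AD n).1.
have mE : measurable E by exact: bigcup_measurable.
have CE n : C n `<=` E.
  by apply: subset_trans (bigcup_sup (i := n) _); rewrite // /D big_ord_recr; exact: subsetUr.
have PEa : P E = a.
  apply/eqP; rewrite eq_le; apply/andP; split.
    have cv : P (D n) @[n --> \oo] --> P E.
      apply: nondecreasing_cvg_mu => //; apply/nondecreasing_seqP => n.
      by apply/subsetPset; rewrite /D [X in _ `<=` X]big_ord_recr; exact: subsetUl.
    rewrite -(cvg_lim _ cv)//; apply: lime_le; first by apply/cvg_ex; exists (P E).
    by apply: nearW => n; exact: ub.
  apply/lee_addgt0Pr => e e0.
  have [n ne] : exists n, (n.+1%:R^-1 < e).
    by have /ltr_add_invr[n] := e0; rewrite add0r; exists n.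
  rewrite -leeBlDr//; apply: le_trans (le_measure _ _ _ (CE n)); last 2 first.
    by rewrite inE; apply: mF; exact: (AC n).1.
    by rewrite inE.
  by apply/ltW/(le_lt_trans _ (aC n)); rewrite leeB// lee_fin ltW.
have FE : F E.
  apply: maximal_insert => // G FG.
  have [Gt|Gt] := leP (P G) t%:E.
    have AG : A G by [].
    have Ga := ltA _ AG; split; last by rewrite PEa lt_eqF.
    left.
    have [n Gn] : exists n, (P G < P (C n))%E.
      have fG : P G \is a fin_num by rewrite fin_num_measure//; exact: mF.
      have : 0 < fine a - fine (P G) by rewrite subr_gt0 fine_lt.
      move=> /ltr_add_invr[n]; rewrite add0r => h; exists n.
      apply: le_lt_trans (aC n).
      by rewrite -(fineK afin) -(fineK fG) -EFinB lee_fin lerBrDr -lerBrDl ltW.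
    apply: subset_trans (CE n).
    exact: strict_chain_le sF FG (AC n).1 (ltW Gn).
  split.
    right => w [n _ Dw]; move: w Dw.
    apply: (@strict_chain_le F) => //; first exact: (AD n).1.
    by apply: le_trans (ltW Gt); exact: (AD n).2.
  by rewrite PEa gt_eqF// (le_lt_trans at_).
have : A E by split => //; rewrite PEa.
by move/ltA; rewrite PEa ltxx.
Qed.

(** Let [C] be a largest member of measure at most [t] and [D] a smallest one of measure at least
    [t]. If both miss [t], atomlessness cuts [D] minus [C] by some [B], and the union of [C] and [B]
    fits strictly between them; it belongs to the chain by maximality and contradicts the choice of
    [C] or of [D]. *)
Lemma maximal_strict_chain_onto F (t : R) : atomless P ->
  maximal_strict_chain F -> 0 <= t <= 1 -> exists2 C, F C & P C = t%:E.
Proof.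
move=> hP maxF /andP[t0 t1]; have [sF _] := maxF; have [mF cF] := sF.
have [C [FC Ct Cmax]] := maximal_strict_chain_below maxF t0.
have t1' : 0 <= 1 - t by rewrite subr_ge0.
have [D' [FD' D't D'max]] := maximal_strict_chain_below (maximal_strict_chainC maxF) t1'.
pose D := ~` D'; have FD : F D by [].
have mD := mF _ FD; have mC := mF _ FC.
have fin A : measurable A -> P A \is a fin_num by move=> mA; rewrite fin_num_measure.
have PC A : measurable A -> P (~` A) = (1 - fine (P A))%:E.
  by move=> mA; rewrite probability_setC// EFinB fineK// fin.
have mD' : measurable D' by rewrite -(setCK D'); exact: measurableC.
have Dt : (t%:E <= P D)%E.
  rewrite /D PC// lee_fin; move: D't; rewrite -(fineK (fin _ mD')) lee_fin; lra.
have Dmin G : F G -> (t%:E <= P G)%E -> (P D <= P G)%E.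
  move=> FG; have mG := mF _ FG => tG.
  have := D'max (~` G); rewrite /= setCK => /(_ FG).
  rewrite /D !PC// lee_fin.
  move: tG; rewrite -(fineK (fin _ mG)) -(fineK (fin _ mD')) !lee_fin => tG h.
  have := h _; lra.
have [Ce|Cne] := eqVneq (P C) t%:E; first by exists C.
have [De|Dne] := eqVneq (P D) t%:E; first by exists D.
have Clt : (P C < t%:E)%E by rewrite lt_neqAle Cne.
have Dlt : (t%:E < P D)%E by rewrite lt_neqAle eq_sym Dne.
have CD : C `<=` D.
  by apply: (strict_chain_le sF) => //; exact: le_trans Dt.
have PDC : (P (D `\` C) = P D - P C)%E.
  by rewrite measureD// ?setIidr// (le_lt_trans (probability_le1 _ _)) ?ltry.
have DC0 : (0 < P (D `\` C))%E.
  by rewrite PDC sube_gt0 (lt_trans Clt).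
have [B [mB BDC B0 BP]] := hP (D `\` C) (measurableD mD mC) DC0.
pose E := C `|` B.
have mE : measurable E by exact: measurableU.
have PE : (P E = P C + P B)%E.
  rewrite measureU//; apply/seteqP; split=> w // -[Cw /BDC[]]//.
have CE : (P C < P E)%E by rewrite PE lteDl// fin.
have ED : (P E < P D)%E.
  by rewrite PE -lteBrDl ?fin// -PDC.
have FE : F E.
  apply: maximal_insert => // G FG.
  have [Gt|Gt] := leP (P G) t%:E.
    have GC := Cmax _ FG Gt; split; last by rewrite lt_eqF// (le_lt_trans GC).
    left; apply: (subset_trans (strict_chain_le sF FG FC GC)); exact: subsetUl.
  have DG := Dmin _ FG (ltW Gt); split; last by rewrite gt_eqF// (lt_le_trans ED).
  right; apply: subset_trans (strict_chain_le sF FD FG DG).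
  by rewrite subUset; split => // w /BDC[].
have [Et|Et] := leP (P E) t%:E.
- by have := Cmax _ FE Et; rewrite leNgt CE.
- by have := Dmin _ FE (ltW Et); rewrite leNgt ED.
Qed.

(** The uniform variable is the level at which a point enters an increasing family [D t] of events
    of probability [t], taken from a maximal chain. *)
Lemma uniform_variable_exists : atomless P ->
  exists2 U : {RV P >-> R}, (forall w, 0 < U w < 1) &
    (forall x : R, 0 <= x <= 1 -> cdf U x = x%:E).
Proof.
move=> hP; have [F maxF] := maximal_strict_chain_exists.
have [sF _] := maxF; have [mF _] := sF.
have selD (t : R) : {D : set T | 0 <= t <= 1 -> F D /\ P D = t%:E}.
  apply: cid; have [t01|nt] := boolP (0 <= t <= 1); last by exists set0.
  by have [C FC Ct] := maximal_strict_chain_onto hP maxF t01; exists C.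
pose D (t : R) := sval (selD t).
have FD (t : R) : 0 <= t <= 1 -> F (D t) by move=> t01; have [] := svalP (selD t) t01.
have PD (t : R) : 0 <= t <= 1 -> P (D t) = t%:E.
  by move=> t01; have [] := svalP (selD t) t01.
have Dle (s t : R) : 0 <= s <= 1 -> 0 <= t <= 1 -> s <= t -> D s `<=` D t.
  move=> s01 t01 st; apply: (strict_chain_le sF); [exact: FD|exact: FD|].
  by rewrite !PD// lee_fin.
(* The added 1 keeps the set nonempty; it is the level of points that enter no [D t]. *)
pose S w := [set t : R | 0 < t < 1 /\ D t w] `|` [set 1].
have Slb w : lbound (S w) 0.
  by move=> t [[/andP[/ltW]]//|->].
have hS w : has_inf (S w) by split; [exists 1; right|exists 0; exact: Slb].
pose V w := inf (S w).
have V_le w (t : R) : 0 < t < 1 -> D t w -> V w <= t.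
  by move=> t01 Dt; apply: ge_inf; [exists 0; exact: Slb|left].
(* Restricting to rational levels makes this a countable union, hence measurable. *)
have V_lt x : x <= 1 -> [set w | V w < x] =
    \bigcup_(q : rat) (if (0 : R) < ratr q < x then D (ratr q) else set0).
  move=> x1; apply/seteqP; split => [w /=|w [q _]]; last first.
    case: ifPn => // /andP[q0 qx] Dq; apply: (le_lt_trans (V_le _ _ _ Dq) qx).
    by rewrite q0 (lt_le_trans qx).
  move=> /(inf_lt (hS w).1)[ t [[/andP[t0 t1] Dt]|->] tx]; last first.
    by have := lt_le_trans tx x1; rewrite ltxx.
  have [q tqx] := rat_in_itvoo tx; move: (tqx); rewrite in_itv/= => /andP[tq qx].
  exists q => //; rewrite (lt_trans t0 tq) qx/=.
  move: Dt; apply: Dle; last exact: ltW.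
  - by rewrite !ltW.
  - by rewrite (ltW (lt_trans t0 tq)) (ltW (lt_le_trans qx _)).
have mV_lt x : x <= 1 -> measurable [set w | V w < x].
  move=> x1; rewrite V_lt//; apply: bigcupT_measurable_rat => q.
  case: ifPn => // /andP[q0 qx]; apply/mF/FD.
  by rewrite (ltW q0) (ltW (lt_le_trans qx _)).
have V_sub (x : R) : 0 < x <= 1 -> [set w | V w < x] `<=` D x.
  move=> /andP[x0 x1]; rewrite V_lt// => w [q _]; case: ifPn => // /andP[q0 qx].
  apply: Dle; last exact: ltW.
  - by rewrite (ltW q0) (ltW (lt_le_trans qx _)).
  - by rewrite ltW.
(* The values 0 and 1 of [V] are taken on a null set only; replacing them by 1/2 puts [U] inside the
   open interval everywhere. *)
pose half : R := 2^-1.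
have half01 : 0 < half < 1 by rewrite /half; apply/andP; split; lra.
pose U w := if 0 < V w < 1 then V w else half.
have U01 w : 0 < U w < 1 by rewrite /U; case: ifPn.
have mV : measurable_fun setT V.
  move=> mT; apply: (measurability _ (RGenInftyO.measurableE R)) => //.
  move=> _ [_ [x ->] <-]; rewrite setTI.
  have [x1|x1] := leP x 1; first exact: mV_lt.
  rewrite (_ : _ @^-1` _ = setT)//; apply/seteqP; split => // w _ /=.
  rewrite in_itv/= (le_lt_trans _ x1)//; apply: ge_inf; last by right.
  by exists 0; exact: Slb.
have mU : measurable_fun setT U.
  apply: measurable_fun_ifT => //; apply: measurable_and; exact: measurable_fun_ltr.
pose U' : {mfun T >-> R} := HB.pack U (isMeasurableFun.Build _ _ _ _ U mU).
exists U' => // x /andP[x0 x1]; rewrite /cdf /distribution /pushforward/=.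
(* The event contains [D (y - e)] for each small [e] and is contained in [D y]. *)
have PVlt (y : R) : 0 < y <= 1 -> P [set w | V w < y] = y%:E.
  move=> y01; have /andP[y0 y1] := y01; apply/eqP; rewrite eq_le; apply/andP; split.
    have y01' : 0 <= y <= 1 by rewrite ltW.
    by rewrite -PD//; apply: le_measure; rewrite ?inE; [exact: mV_lt|exact/mF/FD|exact: V_sub].
  apply/lee_addgt0Pr => e e0.
  have [ye|ey] := leP y e.
    by rewrite (@le_trans _ _ e%:E) ?lee_fin// leeDr.
  have ye01 : 0 < y - e < 1 by rewrite subr_gt0 ey; lra.
  rewrite -leeBlDr// -EFinB -(PD (y - e)); last by case/andP : ye01 => *; rewrite !ltW.
  apply: le_measure; rewrite ?inE.
  - by apply/mF/FD; rewrite !ltW//; case/andP : ye01.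
  - exact: mV_lt.
  by move=> w /(V_le _ _ ye01) /= /le_lt_trans; apply; lra.
have mVle y : measurable [set w | V w <= y].
  by rewrite -[X in measurable X]setTI; apply: measurable_fun_le.
have mVge : measurable [set w | 1 <= V w].
  by rewrite -[X in measurable X]setTI; apply: measurable_fun_le.
have V0 : P [set w | V w <= 0] = 0.
  apply/eqP; rewrite eq_le measure_ge0 andbT; apply/lee_addgt0Pr => e e0.
  have me : 0 < Num.min e 1 <= 1 by rewrite lt_min e0 ltr01/= ge_min lexx orbT.
  rewrite add0e (@le_trans _ _ (Num.min e 1)%:E)//; last by rewrite lee_fin ge_min lexx.
  rewrite -PVlt//; apply: le_measure; rewrite ?inE//; first exact/mV_lt/(andP me).2.
  by move=> w /= /le_lt_trans; apply; case/andP : me.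
have V1 : P [set w | 1 <= V w] = 0.
  have -> : [set w | 1 <= V w] = ~` [set w | V w < 1].
    by apply/seteqP; split => w /=; rewrite leNgt => /negP.
  rewrite probability_setC; last exact: mV_lt.
  by rewrite PVlt ?ltr01 ?lexx// subee.
pose N := [set w | V w <= 0] `|` [set w | 1 <= V w].
have mN : measurable N by exact: measurableU.
have PN : P N = 0 by rewrite /N measureU0.
have UV w : ~ N w -> U w = V w.
  rewrite /N/= => /not_orP[/negP + /negP]; rewrite -!ltNge /U => -> ->//.
set A := _ @^-1` _.
have mA : measurable A by exact: measurable_funPTI U' _ _.
have [xe|xne0] := eqVneq x 0.
  rewrite xe (_ : A = set0) ?measure0//; apply/seteqP; split => // w /=.
  by rewrite /A/= in_itv/= xe leNgt (andP (U01 w)).1.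
have [xe|xne1] := eqVneq x 1.
  rewrite xe (_ : A = setT) ?probability_setT//; apply/seteqP; split => // w _ /=.
  by rewrite /A/= in_itv/= xe ltW// (andP (U01 w)).2.
have x01 : 0 < x < 1 by rewrite !lt_neqAle x0 x1 xne1 eq_sym xne0.
have x01' : 0 < x <= 1 by case/andP : x01 => -> /ltW.
apply/eqP; rewrite eq_le; apply/andP; split; last first.
  rewrite -PVlt// -(measureU0 (B := N) (mu := P) mA)//.
  apply: le_measure; rewrite ?inE; [exact: mV_lt|exact: measurableU|].
  move=> w /= Vx; have [Nw|Nw] := pselect (N w); first by right.
  by left; rewrite /A/= in_itv/= UV// ltW.
apply/lee_addgt0Pr => e e0.
(* The cap at 1 keeps [y] in the range where [PVlt] applies. *)
pose y := Num.min (x + e) 1.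
have y01 : 0 < y <= 1.
  by rewrite lt_min ltr01 andbT ge_min lexx orbT andbT addr_gt0//; case/andP : x01.
have xy : x < y by rewrite lt_min ltrDl e0; case/andP : x01.
apply: (@le_trans _ _ y%:E); last by rewrite -EFinD lee_fin ge_min lexx.
rewrite -PVlt// -[leRHS](measureU0 (B := N) (mu := P))//; last exact/mV_lt/(andP y01).2.
apply: le_measure; rewrite ?inE//.
  by apply: measurableU => //; exact/mV_lt/(andP y01).2.
move=> w; rewrite /A/= in_itv/= => Ux.
have [Nw|Nw] := pselect (N w); first by right.
by left => /=; rewrite -UV// (le_lt_trans Ux).
Qed.

End uniform_variable.

(** * Laws, essential bounds and value at risk *)

(** The half-lines are closed under intersection, generate the Borel sets and exhaust the line with
    finite measure. *)
Lemma finite_measure_cdf_unique (R : realType)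
    (m1 m2 : {measure set R -> \bar R}) :
  (forall x : R, m1 `]-oo, x]%classic < +oo)%E ->
  (forall x : R, m1 `]-oo, x]%classic = m2 `]-oo, x]%classic) ->
  forall B, measurable B -> m1 B = m2 B.
Proof.
move=> fin m12 B mB.
pose G : set (set R) := [set A | exists x : R, A = `]-oo, x]%classic].
apply: (@measure_unique _ _ _ G (fun n : nat => `]-oo, n%:R]%classic)) => //.
- rewrite [LHS]RGenOInfty.measurableE; apply/seteqP; split => A.
    apply: smallest_sub; first exact: smallest_sigma_algebra.
    move=> _ [x ->]; rewrite -setCitvl -setTD.
    have [_ + _] := smallest_sigma_algebra setT G; apply.
    by apply: sub_sigma_algebra; exists x.
  apply: smallest_sub; first exact: smallest_sigma_algebra.
  move=> _ [x ->]; rewrite -setCitvr -setTD.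
  have [_ + _] := smallest_sigma_algebra setT (@RGenOInfty.G R); apply.
  by apply: sub_sigma_algebra; exists x.
- move=> _ _ [x ->] [y ->]; exists (Num.min x y); apply/seteqP.
  by split => z /=; rewrite !in_itv/= le_min => /andP.
- by move=> n; exists n%:R.
- apply/seteqP; split => // x _; exists (Num.truncn x).+1 => //=.
  by rewrite in_itv/= ltW// Num.Theory.truncnS_gt.
- by move=> _ [x ->].
Qed.

(** Two underlying spaces are allowed so that a variable can be compared with its quantile function
    on the unit interval. *)
Lemma cdf_distribution (R : realType) (d1 d2 : measure_display)
    (T1 : measurableType d1) (T2 : measurableType d2)
    (P1 : probability T1 R) (P2 : probability T2 R)
    (X : {RV P1 >-> R}) (Y : {RV P2 >-> R}) :
  cdf X =1 cdf Y ->
  forall B : set R, measurable B -> distribution P1 X B = distribution P2 Y B.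
Proof.
move=> XY; apply: finite_measure_cdf_unique => x; last exact: XY.
by rewrite (le_lt_trans (probability_le1 _ _))// ltry.
Qed.

Section essentially_bounded.
Context (d : measure_display) (T : measurableType d) (R : realType).
Variable P : probability T R.

Lemma probability_setT_gt0 : (0 < P [set: T])%E.
Proof. by rewrite probability_setT. Qed.

Lemma Linfty_bounded (X : Linfty P) :
  exists2 M : R, 0 <= M & \forall w \ae P, `|X w| <= M.
Proof.
have := Lfunction_finite _ X; rewrite /finite_norm unlock /Lnorm.
case: ifPn => [_ fin|/negP[]]; last exact: probability_setT_gt0.
pose M := ess_sup P (abse \o (EFin \o X)).
have M0 : (0 <= M)%E.
  apply: (ess_sup_gee probability_setT_gt0).
  by apply: nearW => w /=; rewrite lee_fin.
have Mfin : M \is a fin_num by rewrite ge0_fin_numE.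
exists (fine M); first exact: fine_ge0.
have := ess_sup_ge P (abse \o (EFin \o X)).
by apply: filterS => w /=; rewrite -lee_fin fineK.
Qed.

Lemma bounded_Linfty (f : T -> R) (M : R) : measurable_fun setT f ->
  (forall w, `|f w| <= M) -> f \in Lfun P +oo%E.
Proof.
move=> mf fM; rewrite inE; apply/andP; split; rewrite inE//=.
rewrite /finite_norm unlock /Lnorm.
case: ifPn => // _.
apply: le_lt_trans (ltry M); apply/ess_supP; apply: nearW => w /=.
by rewrite lee_fin.
Qed.

Lemma ae_probability1 (A : set T) : measurable A -> (\forall w \ae P, A w) ->
  P A = 1%:E.
Proof.
move=> mA [N [mN PN AN]].
have : P (~` A) = 0.
  apply/eqP; rewrite eq_le measure_ge0 andbT -PN.
  by apply: le_measure; rewrite ?inE//; exact: measurableC.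
rewrite probability_setC// => /eqP; rewrite sube_eq ?fin_num_measure//.
by rewrite add0e => /eqP <-.
Qed.

Lemma LinftyD (X Y : Linfty P) w : (X + Y) w = X w + Y w. Proof. by []. Qed.

Lemma ae_exists (A : set T) (Q : T -> Prop) : measurable A -> (0 < P A)%E ->
  (\forall w \ae P, Q w) -> exists2 w, A w & Q w.
Proof.
move=> mA A0 [N [mN PN QN]]; apply: contrapT => h.
suff : (P A <= 0)%E by rewrite leNgt A0.
rewrite -PN; apply: le_measure; rewrite ?inE// => w Aw; apply: QN => Qw.
by apply: h; exists w.
Qed.

End essentially_bounded.

Section value_at_risk.
Context (d : measure_display) (T : measurableType d) (R : realType).
Variable P : probability T R.
Implicit Type X : {RV P >-> R}.

Lemma cdf_fin_num X (x : R) : cdf X x \is a fin_num.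
Proof. by rewrite fin_num_measure. Qed.

(** Right continuity of the distribution function makes the infimum a minimum. Its limits at both
    infinities make the set nonempty and bounded below, so that [inf] does not take its default
    value. *)
Lemma VaR_le X (s x : R) : 0 < s < 1 -> (VaR P s X <= x) = (s%:E <= cdf X x)%E.
Proof.
move=> /andP[s0 s1]; rewrite /VaR; set S := [set x | _].
have S0 : S !=set0.
  have : \forall x \near +oo%R, (s%:E < cdf X x)%E.
    by move/cvg_cdfy1 : (X) => /(_ _ (@open_ereal_gt' _ 1%E s%:E _)); apply; rewrite lte_fin.
  case=> M [_ h]; exists (M + 1); apply/ltW/h; lra.
have [m Sm] : exists m, lbound S m.
  have : \forall x \near -oo%R, (cdf X x < s%:E)%E.
    by move/cvg_cdfNy0 : (X) => /(_ _ (@open_ereal_lt' _ 0%E s%:E _)); apply; rewrite lte_fin.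
  case=> M [_ h]; exists (M - 1) => y Sy; rewrite leNgt; apply/negP => yM.
  have : (cdf X y < s%:E)%E by apply: h; lra.
  by rewrite ltNge Sy.
have hS : has_lbound S by exists m.
apply/idP/idP => [ix|]; last by move=> sx; apply: ge_inf.
apply: (@le_trans _ _ (cdf X (inf S))); last exact: cdf_nondecreasing.
have rc : cdf X y @[y --> (inf S)^'+] --> cdf X (inf S) by exact: cdf_right_continuous.
rewrite -(cvg_lim _ rc)//; apply: lime_ge; first by apply/cvg_ex; exists (cdf X (inf S)).
near=> y.
have /(inf_lt S0)[z Sz zy] : inf S < y by near: y; exact: nbhs_right_gt.
by apply: (le_trans Sz); apply: cdf_nondecreasing; exact: ltW.
Unshelve. all: by end_near. Qed.

End value_at_risk.

(** * The quantile function and the Rockafellar-Uryasev formula *)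

Lemma uniform_prob01E (R : realType) (A : set (measurableTypeR R)) :
  measurable A -> uniform_prob (@ltr01 R) A = lebesgue_measure (A `&` `[0, 1]).
Proof.
move=> mA; rewrite -[in LHS](setIT A) -integral_indic// integral_uniform//.
  by rewrite subr0 invr1 mul1e integral_indic.
by apply/measurable_EFinP; exact: measurable_indic.
Qed.

Lemma bounded_integrable (d : measure_display) (T : measurableType d) (R : realType)
    (mu : {measure set T -> \bar R}) (A : set T) (f : T -> R) (M : R) :
  measurable A -> (mu A < +oo)%E -> measurable_fun setT f ->
  (forall x, `|f x| <= M) -> mu.-integrable A (EFin \o f).
Proof.
move=> mA fin mf fM; apply: measurable_bounded_integrable => //.
  exact: measurable_funTS.
by exists M; split; [exact: num_real|move=> y /ltW My x _; exact: le_trans My].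
Qed.

Lemma lebesgue_measure_itv_lty (R : realType) (a b : R) (b0 b1 : bool) :
  (lebesgue_measure [set` Interval (BSide b0 a) (BSide b1 b)] < +oo)%E.
Proof. by rewrite lebesgue_measure_itv/=; case: ifPn => _; rewrite -?EFinB ltry. Qed.

Section quantile.
Context (d : measure_display) (T : measurableType d) (R : realType).
Variable P : probability T R.
Variables (X : {RV P >-> R}) (M : R).
Hypothesis XM : \forall w \ae P, `|X w| <= M.

Lemma cdf_lt_bound (x : R) : x < - M -> cdf X x = 0%E.
Proof.
move=> xM; pose A := [set w | - M <= X w].
have mA : measurable A.
  by rewrite -[A]setTI; apply: measurable_fun_le => //; exact: measurable_funP.
have PA : P A = 1%:E.
  by apply: ae_probability1 => //; apply: filterS XM => w; rewrite ler_norml => /andP[].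
apply/eqP; rewrite eq_le cdf_ge0 andbT.
have <- : P (~` A) = 0 by rewrite probability_setC// PA subee.
rewrite -[cdf X x]/(P (X @^-1` `]-oo, x])).
apply: le_measure; rewrite ?inE; [exact: measurable_funPTI|exact: measurableC|].
move=> w /=; rewrite in_itv/= /A/= => Xx; apply/negP.
by rewrite -ltNge (le_lt_trans Xx).
Qed.

Lemma cdf_ge_bound x : M <= x -> cdf X x = 1%E.
Proof.
move=> Mx; rewrite -[cdf X x]/(P (X @^-1` `]-oo, x])).
apply: ae_probability1; first exact: measurable_funPTI.
apply: filterS XM => w; rewrite ler_norml => /andP[_ XMw] /=.
by rewrite in_itv/= (le_trans XMw).
Qed.

Lemma VaR_bound (s : R) : 0 < s < 1 -> - M <= VaR P s X <= M.
Proof.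
move=> s01; have /andP[s0 s1] := s01; apply/andP; split; last first.
  by rewrite VaR_le// cdf_ge_bound// lee_fin ltW.
rewrite leNgt; apply/negP => h.
have : VaR P s X <= (VaR P s X - M) / 2 by lra.
rewrite VaR_le// cdf_lt_bound; last by lra.
by rewrite lee_fin leNgt s0.
Qed.

(** Extending [VaR] by the essential bounds outside the open unit interval gives a monotone bounded
    function on the whole line, hence measurable and integrable on every bounded interval. *)
Definition quantile (s : R) : R :=
  if s <= 0 then - M else if s < 1 then VaR P s X else M.

Lemma quantile_VaR s : 0 < s < 1 -> quantile s = VaR P s X.
Proof. by rewrite /quantile => /andP[s0 ->]; rewrite leNgt s0. Qed.

Lemma quantile_ge1 s : 1 <= s -> quantile s = M.
Proof.
by move=> s1; rewrite /quantile leNgt (lt_le_trans ltr01 s1)/= ltNge s1.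
Qed.

Lemma essential_bound_ge0 : 0 <= M.
Proof.
pose half : R := 2^-1.
have h : 0 < half < 1 by rewrite /half; apply/andP; split; lra.
by have /andP[] := VaR_bound h; lra.
Qed.

Lemma quantile_bound s : `|quantile s| <= M.
Proof.
have M0 := essential_bound_ge0; rewrite /quantile.
have [s0|s0] := leP s 0; first by rewrite normrN ger0_norm.
have [s1|s1] := ltP s 1; last by rewrite ger0_norm.
by rewrite ler_norml VaR_bound// s0.
Qed.

Lemma quantile_le s x : 0 < s < 1 -> (quantile s <= x) = (s%:E <= cdf X x)%E.
Proof. by move=> s01; rewrite quantile_VaR// VaR_le. Qed.

Lemma nondecreasing_quantile : nondecreasing_fun quantile.
Proof.
move=> s t st; have [s0|s0] := leP s 0.
  by rewrite [leLHS]/quantile s0; have := quantile_bound t; rewrite ler_norml => /andP[].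
have t0 := lt_le_trans s0 st.
have [t1|t1] := ltP t 1; last first.
  by rewrite (quantile_ge1 t1); have := quantile_bound s; rewrite ler_norml => /andP[].
have s1 := le_lt_trans st t1.
rewrite quantile_le ?s0//; apply: (@le_trans _ _ t%:E); first by rewrite lee_fin.
by rewrite -quantile_le ?t0.
Qed.

Lemma measurable_quantile :
  measurable_fun [set: measurableTypeR R] (quantile : measurableTypeR R -> R).
Proof. by apply: nondecreasing_measurable => //; exact: nondecreasing_quantile. Qed.

#[local] HB.instance Definition _ :=
  @isMeasurableFun.Build _ _ _ _ (quantile : measurableTypeR R -> R) measurable_quantile.

(** With [c] the value of the distribution function at [x], the points of the unit interval where
    the quantile is at most [x] contain the open interval from 0 to [c] and lie in the closed
    one. *)
Lemma distribution_quantile (B : set R) : measurable B ->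
  distribution P X B =
  distribution (uniform_prob (@ltr01 R)) (quantile : measurableTypeR R -> R) B.
Proof.
move: B; apply: cdf_distribution => x.
have fc := cdf_fin_num X x.
pose c := fine (cdf X x).
have cE : cdf X x = c%:E by rewrite fineK.
have c0 : 0 <= c by rewrite fine_ge0// cdf_ge0.
have c1 : c <= 1 by rewrite -lee_fin -cE cdf_le1.
pose A := (quantile : measurableTypeR R -> R) @^-1` `]-oo, x]%classic.
rewrite -[RHS]/(uniform_prob (@ltr01 R) A).
have mA : measurable A by exact: measurable_funPTI.
rewrite uniform_prob01E// cE; apply/eqP; rewrite eq_le; apply/andP; split.
  have -> : c%:E = lebesgue_measure (`]0, c[%classic : set R).
    rewrite lebesgue_measure_itv/= lte_fin; have [->|cn0] := eqVneq c 0.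
      by rewrite ltxx.
    by rewrite lt_neqAle eq_sym cn0 c0 sube0.
  apply: le_measure; rewrite ?inE; [by []|exact: measurableI|].
  move=> s /=; rewrite in_itv/= => /andP[s0 sc].
  have s1 := lt_le_trans sc c1.
  by rewrite /A/= !in_itv/= quantile_le ?s0// cE lee_fin !ltW.
have -> : c%:E = lebesgue_measure (`[0, c]%classic : set R).
  rewrite lebesgue_measure_itv/= lte_fin; have [->|cn0] := eqVneq c 0.
    by rewrite ltxx.
  by rewrite lt_neqAle eq_sym cn0 c0 sube0.
apply: le_measure; rewrite ?inE; [exact: measurableI|by []|].
move=> s /=; rewrite /A/= !in_itv/= => -[+ /andP[s0 s1]]; rewrite s0/=.
have [-> _//|sn0] := eqVneq s 0.
have [->|sn1] := eqVneq s 1.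
  by rewrite quantile_ge1// => Mx; rewrite -lee_fin -cE cdf_ge_bound.
by rewrite quantile_le ?cE ?lee_fin// !lt_neqAle eq_sym sn0 s0 sn1 s1.
Qed.

Lemma integral_quantile (f : R -> R) :
  measurable_fun setT f -> (forall x, 0 <= f x) ->
  (\int[P]_w (f (X w))%:E =
   \int[lebesgue_measure]_(s in `[0%R, 1%R]) (f (quantile s))%:E)%E.
Proof.
move=> mf f0; have mEf : measurable_fun setT (EFin \o f) by exact/measurable_EFinP.
rewrite -(@ge0_integral_distribution _ _ _ _ _ P X (EFin \o f))//.
rewrite (eq_measure_integral (distribution (uniform_prob (@ltr01 R))
  (quantile : measurableTypeR R -> R))); last first.
  by move=> A mA _; exact: distribution_quantile.
rewrite ge0_integral_distribution//.
rewrite integral_uniform//.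
- by rewrite subr0 invr1 mul1e.
- exact: measurableT_comp.
- by move=> x; rewrite lee_fin.
Qed.

Lemma integrable_itv_quantile (a b : R) (b0 b1 : bool) :
  (@lebesgue_measure R).-integrable [set` Interval (BSide b0 a) (BSide b1 b)]
    (EFin \o quantile).
Proof.
apply: (@bounded_integrable _ _ _ _ _ _ M) => //.
- exact: lebesgue_measure_itv_lty.
- exact: quantile_bound.
Qed.

Lemma excess_quantile x : \int[P]_w Num.max (X w - x) 0 =
  \int[lebesgue_measure]_(s in `[0, 1]) Num.max (quantile s - x) 0.
Proof.
congr fine; rewrite (@integral_quantile (fun y => Num.max (y - x) 0))//.
  by apply: measurable_maxr => //; exact: measurable_funB.
by move=> y; rewrite le_max lexx orbT.
Qed.

Lemma integrable_itv_excess x (a b : R) (b0 b1 : bool) :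
  (@lebesgue_measure R).-integrable [set` Interval (BSide b0 a) (BSide b1 b)]
    (EFin \o (fun s => Num.max (quantile s - x) 0)).
Proof.
apply: (@bounded_integrable _ _ _ _ _ _ (M + `|x|)) => //.
- exact: lebesgue_measure_itv_lty.
- apply: measurable_maxr => //; apply: measurable_funB => //; exact: measurable_quantile.
- move=> s; rewrite ger0_norm ?le_max ?lexx ?orbT// ge_max.
  rewrite addr_ge0 ?essential_bound_ge0// andbT.
  apply: (le_trans (ler_norm _)); apply: (le_trans (ler_normB _ _)).
  by rewrite lerD2r quantile_bound.
Qed.

Lemma ES_quantile (p : R) : 0 < p < 1 ->
  (1 - p) * ES P p X = \int[lebesgue_measure]_(s in `]p, 1[) quantile s.
Proof.
move=> /andP[p0 p1]; rewrite /ES mulrA mulfV ?subr_eq0 ?gt_eqF// mul1r.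
apply: eq_Rintegral => s; rewrite inE/= in_itv/= => /andP[ps s1].
by rewrite quantile_VaR// s1 (lt_trans p0).
Qed.

Lemma ES_shift_quantile (p x : R) : 0 < p < 1 ->
  (1 - p) * (ES P p X - x) = \int[lebesgue_measure]_(s in `]p, 1[) (quantile s - x).
Proof.
move=> p01; have /andP[p0 p1] := p01.
rewrite RintegralB//; last 2 first.
- exact: integrable_itv_quantile.
- by apply: (@bounded_integrable _ _ _ _ _ _ `|x|) => //; exact: lebesgue_measure_itv_lty.
rewrite Rintegral_cst//= -ES_quantile// lebesgue_measure_itv/= lte_fin p1/= mulrBr.
by rewrite [x * _]mulrC.
Qed.

Lemma excess_itv (p x : R) : 0 < p < 1 ->
  \int[P]_w Num.max (X w - x) 0 =
  \int[lebesgue_measure]_(s in `[0, p]) Num.max (quantile s - x) 0 +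
  \int[lebesgue_measure]_(s in `]p, 1[) Num.max (quantile s - x) 0.
Proof.
move=> /andP[p0 p1]; rewrite excess_quantile (@itv_bndbnd_setU _ _ _ (BRight p)); last 2 first.
- by rewrite bnd_simp ltW.
- by rewrite bnd_simp ltW.
rewrite Rintegral_setU//.
(* The endpoint 1 is dropped because it is a null set. *)
- congr (_ + _); rewrite -Rintegral_itv_bndo_bndc//.
  exact: integrable_itv_excess.
- rewrite -itv_bndbnd_setU ?bnd_simp ?ltW//; exact: integrable_itv_excess.
- apply/disj_setPS => s [] /=; rewrite !in_itv/= => /andP[_ sp] /andP[].
  by rewrite ltNge sp.
Qed.

(** Above [p] the excess dominates [quantile s - x], and its integral up to [p] is nonnegative. *)
Lemma ES_le_excess (p x : R) : 0 < p < 1 ->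
  (1 - p) * (ES P p X - x) <= \int[P]_w Num.max (X w - x) 0.
Proof.
move=> p01; rewrite ES_shift_quantile// (excess_itv x p01).
rewrite -[leLHS]add0r lerD//.
  by apply: Rintegral_ge0 => s _; rewrite le_max lexx orbT.
apply: le_Rintegral => //.
- apply: (@bounded_integrable _ _ _ _ _ _ (M + `|x|)) => //.
  + exact: lebesgue_measure_itv_lty.
  + by apply: measurable_funB => //; exact: measurable_quantile.
  + by move=> s; rewrite (le_trans (ler_normB _ _))// lerD2r quantile_bound.
- exact: integrable_itv_excess.
- by move=> s _; rewrite le_max lexx.
Qed.

(** At this level monotonicity of the quantile function makes the excess vanish up to [p] and equal
    the difference above [p], so both estimates of [ES_le_excess] are equalities. *)
Lemma ES_excess_VaR (p : R) : 0 < p < 1 ->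
  (1 - p) * (ES P p X - VaR P p X) = \int[P]_w Num.max (X w - VaR P p X) 0.
Proof.
move=> p01; rewrite ES_shift_quantile// (excess_itv _ p01) -quantile_VaR//.
rewrite [X in _ = X + _](_ : _ = 0) ?add0r; last first.
  rewrite /Rintegral integral0_eq// => s; rewrite /= in_itv/= => /andP[_ sp].
  congr EFin.
  by apply/max_idPr; rewrite subr_le0 nondecreasing_quantile.
apply: eq_Rintegral => s; rewrite inE/= in_itv/= => /andP[ps _].
by apply/esym/max_idPl; rewrite subr_ge0 nondecreasing_quantile// ltW.
Qed.

End quantile.

Arguments quantile {d T R} P X M s.

(** * Axioms of the expected shortfall *)

Section expected_shortfall.
Context (d : measure_display) (T : measurableType d) (R : realType).
Variables (P : probability T R) (p : R).
Hypothesis p01 : 0 < p < 1.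
Implicit Types X Y : Linfty P.

Lemma integrable_Linfty X (A : set T) : measurable A -> P.-integrable A (EFin \o X).
Proof.
move=> mA; apply: (integrableS measurableT) => //.
apply/Lfun1_integrable.
apply: (Lfun_subset (lexx 1%E) (leey 1%E) _ (leey 1%E)); first by rewrite fin_num_measure.
exact: LfunP.
Qed.

Lemma integrable_cst (A : set T) (c : R) : measurable A -> P.-integrable A (EFin \o cst c).
Proof. exact: finite_measure_integrable_cst. Qed.

Lemma integrable_shift X x (A : set T) : measurable A ->
  P.-integrable A (EFin \o (fun w => X w - x)).
Proof.
move=> mA; apply: (@integrableB _ _ _ _ _ mA (EFin \o X) (EFin \o cst x)).
  exact: integrable_Linfty.
exact: integrable_cst.
Qed.

Lemma integrable_excess X x (A : set T) : measurable A ->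
  P.-integrable A (EFin \o (fun w => Num.max (X w - x) 0)).
Proof.
move=> mA; apply: (le_integrable mA _ _ (integrable_shift X x mA)).
  apply/measurable_EFinP; apply: measurable_maxr => //; apply: measurable_funB => //.
  exact: measurable_funTS.
move=> w _; rewrite /= lee_fin ger0_norm ?le_max ?lexx ?orbT//.
by rewrite ge_max ler_norm normr_ge0.
Qed.

Let p1_gt0 : 0 < 1 - p. Proof. by rewrite subr_gt0; case/andP : p01. Qed.

Lemma ES_excess_upper X x : (1 - p) * (ES P p X - x) <= \int[P]_w Num.max (X w - x) 0.
Proof. by have [M _ XM] := Linfty_bounded X; exact: ES_le_excess XM _ _ p01. Qed.

Lemma ES_excess_attained X :
  (1 - p) * (ES P p X - VaR P p X) = \int[P]_w Num.max (X w - VaR P p X) 0.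
Proof. by have [M _ XM] := Linfty_bounded X; exact: ES_excess_VaR XM _ p01. Qed.

Lemma eq_law_ES X Y : eq_law P X Y -> ES P p X = ES P p Y.
Proof.
move=> XY; congr (_ * _); apply: eq_Rintegral => s _; congr inf.
by apply/seteqP; split => x /=; rewrite /cdf XY.
Qed.

#[local] Opaque ES VaR.

(** Inequalities between shortfalls are proved at a level [v] where the right side becomes an exact
    expected excess, while the left side is bounded by its own expected excess at [v]. *)
Let cancel_shift (a b v : R) : (1 - p) * (a - v) <= (1 - p) * (b - v) -> a <= b.
Proof. by rewrite ler_pM2l// lerD2r. Qed.

Lemma le_ES X Y : (forall w, X w <= Y w) -> ES P p X <= ES P p Y.
Proof.
move=> XY; apply: (cancel_shift (v := VaR P p Y)); rewrite [leRHS]ES_excess_attained.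
apply: (le_trans (ES_excess_upper _ _)); apply: le_Rintegral => //.
- exact: integrable_excess.
- exact: integrable_excess.
- by move=> w _; apply: le_max2; rewrite ?lerD2r.
Qed.

(** The positive part is subadditive, and the sum of the two values at risk serves as level for
    [X + Y]. *)
Lemma ESD X Y : ES P p (X + Y) <= ES P p X + ES P p Y.
Proof.
rewrite (cancel_shift (v := VaR P p X + VaR P p Y))//.
rewrite [in leRHS]opprD [in leRHS]addrACA [leRHS]mulrDr.
rewrite (ES_excess_attained X) (ES_excess_attained Y).
apply: (le_trans (ES_excess_upper _ _)).
rewrite -RintegralD//; [|exact: integrable_excess|exact: integrable_excess].
apply: le_Rintegral => //.
- exact: integrable_excess.
- apply: (@integrableD _ _ _ _ _ _ (EFin \o (fun w => Num.max (X w - VaR P p X) 0))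
    (EFin \o (fun w => Num.max (Y w - VaR P p Y) 0))) => //; exact: integrable_excess.
- move=> w _; rewrite LinftyD opprD addrACA ge_max.
  by rewrite lerD ?le_max ?lexx// addr_ge0// le_max lexx orbT.
Qed.

Lemma ES_translation X c : ES P p (X + Linfty_cst P c) = ES P p X + c.
Proof.
(* One inequality is enough: applied to the translated variable with [- c] it yields the other. *)
have le_side Y a : ES P p (Y + Linfty_cst P a) <= ES P p Y + a.
  apply: (cancel_shift (v := VaR P p Y + a)).
  rewrite [in leRHS](opprD (VaR P p Y)) [in leRHS]addrACA subrr addr0.
  rewrite [leRHS]ES_excess_attained; apply: (le_trans (ES_excess_upper _ _)).
  rewrite le_eqVlt; apply/orP; left; apply/eqP.
  apply: eq_Rintegral => w _; rewrite LinftyD /=.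
  by congr Num.max; ring.
apply/eqP; rewrite eq_le le_side/=.
have := le_side (X + Linfty_cst P c) (- c).
have -> : X + Linfty_cst P c + Linfty_cst P (- c) = X.
  by apply/LfuneqP => w; rewrite !LinftyD/= addrK.
by rewrite -lerBlDr opprK.
Qed.

Lemma ES0 : ES P p (0 : Linfty P) = 0.
Proof.
(* The essential bound 0 forces the quantile function to vanish identically. *)
have X0 : \forall w \ae P, `|(0 : Linfty P) w| <= 0 by apply: nearW => w; rewrite normr0.
apply/eqP; rewrite -(mulrI_eq0 _ (mulfI (lt0r_neq0 p1_gt0))); apply/eqP.
rewrite (ES_quantile (0 : Linfty P) 0 p01)/= /Rintegral integral0_eq// => s _; congr EFin.
by apply/eqP; rewrite -normr_le0 (quantile_bound X0).
Qed.

Lemma Rintegral_setC (f : T -> R) B : measurable B -> P.-integrable setT (EFin \o f) ->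
  \int[P]_w f w = \int[P]_(w in B) f w + \int[P]_(w in ~` B) f w.
Proof.
move=> mB intf; rewrite -Rintegral_setU ?setUv//; first exact: measurableC.
by apply/disj_setPS => w [].
Qed.

Lemma Rintegral_shift X B x : measurable B -> P B = (1 - p)%:E ->
  \int[P]_(w in B) (X w - x) = \int[P]_(w in B) X w - (1 - p) * x.
Proof.
move=> mB PB; rewrite RintegralB//; [|exact: integrable_Linfty|exact: integrable_cst].
congr (_ - _); rewrite Rintegral_cst//; transitivity (x * fine (P B)) => //.
by rewrite PB mulrC.
Qed.

(** At the level [VaR_p] the shortfall is an exact expected excess, which dominates the integral of
    [X - x] over any event. *)
Lemma ES_ge_mean X B : measurable B -> P B = (1 - p)%:E ->
  \int[P]_(w in B) X w <= (1 - p) * ES P p X.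
Proof.
move=> mB PB; set x := VaR P p X.
suff : \int[P]_(w in B) (X w - x) <= (1 - p) * (ES P p X - x).
  by rewrite Rintegral_shift// mulrBr lerD2r.
rewrite ES_excess_attained -/x (Rintegral_setC mB); last exact: integrable_excess.
rewrite -[leLHS]addr0 lerD//; last by apply: Rintegral_ge0 => w _; rewrite le_max lexx orbT.
apply: le_Rintegral => //.
- exact: integrable_shift.
- exact: integrable_excess.
- by move=> w _; rewrite le_max lexx.
Qed.

(** The level is the infimum of [X] over the points of [A] that dominate almost all of the
    complement. It is finite because [X] is essentially bounded and the complement is not null. *)
Lemma tail_event_level X A : tail_event P X A ->
  exists x, (\forall w \ae P, A w -> x <= X w) /\ (\forall w \ae P, ~ A w -> X w <= x).
Proof.
move=> [mA A0 A1 tA]; have [M _ XM] := Linfty_bounded X.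
have mAc : measurable (~` A) by exact: measurableC.
have Ac0 : (0 < P (~` A))%E by rewrite probability_setC// sube_gt0.
pose G := [set w | A w /\ \forall w' \ae P, ~ A w' -> X w' <= X w].
have [w0 Aw0 Gw0] := ae_exists mA A0 tA.
have G0 : X @` G !=set0 by exists (X w0), w0 => //; split => //; exact: Gw0.
have Glb : lbound (X @` G) (- M).
  move=> _ [w [Aw Gw] <-].
  have h : \forall w' \ae P, ~ A w' -> - M <= X w.
    apply: filterS2 Gw XM => w' Xw' + nA; rewrite ler_norml => /andP[+ _] => /le_trans.
    by apply; exact: Xw'.
  by have [w' Aw'] := ae_exists mAc Ac0 h; apply.
have hi : has_inf (X @` G) by split => //; exists (- M).
exists (inf (X @` G)); split.
  apply: filterS tA => w Gw Aw; apply: ge_inf; first by exists (- M).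
  by exists w => //; split => //; exact: Gw.
(* A minimizing sequence leaves only countably many null sets to discard. *)
have seqw n : {w | G w /\ X w < inf (X @` G) + n.+1%:R^-1}.
  apply: cid; have n0 : 0 < (n.+1%:R^-1 : R) by rewrite invr_gt0.
  by have [_ [w Gw <-] wn] := inf_adherent n0 hi; exists w.
have : \forall w \ae P, forall n, ~ A w -> X w <= X (sval (seqw n)).
  by apply/ae_foralln => n; have [[]] := svalP (seqw n).
apply: filterS => w h nA; apply/ler_addgt0Pr => e e0.
have /ltr_add_invr[n] := e0; rewrite add0r => ne.
apply: (le_trans (h n nA)); apply/ltW/(lt_trans (svalP (seqw n)).2).
by rewrite ltrD2l.
Qed.

(** At a level separating [A] from its complement, the excess is almost surely [X - x] on [A] and 0
    elsewhere. *)
Lemma ES_tail X A : p_tail_event P p X A -> (1 - p) * ES P p X <= \int[P]_(w in A) X w.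
Proof.
move=> [tA PA]; have [mA _ _ _] := tA; have [x [xA Ax]] := tail_event_level tA.
suff : (1 - p) * (ES P p X - x) <= \int[P]_(w in A) (X w - x).
  by rewrite Rintegral_shift// mulrBr lerD2r.
apply: (le_trans (ES_excess_upper _ _)).
rewrite (Rintegral_setC mA); last exact: integrable_excess.
have mAc : measurable (~` A) by exact: measurableC.
rewrite le_eqVlt; apply/orP; left; apply/eqP; rewrite -[RHS]addr0; congr (_ + _).
  congr fine; apply: ae_eq_integral => //.
  - exact: measurable_int (integrable_excess X x mA).
  - exact: measurable_int (integrable_shift X x mA).
  - apply: filterS xA => w xX /xX; rewrite -subr_ge0 => /max_idPl -> //.
rewrite -[RHS](mul0r (fine (P (~` A)))) -Rintegral_cst//; congr fine.
apply: ae_eq_integral => //; first exact: measurable_int (integrable_excess X x mAc).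
by apply: filterS Ax => w Xx /Xx; rewrite -subr_le0 => /max_idPr ->.
Qed.

(** After subadditivity and law invariance, both shortfalls are bounded by integrals over the common
    tail event [A]. These add up to the integral of [X' + Y'] over [A], which [ES_ge_mean]
    bounds. *)
Lemma ES_concentration_averse X Y X' Y' : p_concentrated P p X' Y' ->
  eq_law P X X' -> eq_law P Y Y' -> ES P p (X + Y) <= ES P p (X' + Y').
Proof.
move=> [A [tX tY]] /eq_law_ES XX' /eq_law_ES YY'.
have [[mA _ _ _] PA] := tX.
apply: (le_trans (ESD X Y)); rewrite XX' YY' -(ler_pM2l p1_gt0) [leLHS]mulrDr.
apply: (le_trans (lerD (ES_tail tX) (ES_tail tY))).
apply: (le_trans _ (ES_ge_mean (X' + Y') mA PA)).
rewrite le_eqVlt; apply/orP; left; apply/eqP/esym.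
pose f w := X' w; pose g w := Y' w.
apply: (@RintegralD _ _ _ P A f g mA).
- exact: (integrable_Linfty X' mA).
- exact: (integrable_Linfty Y' mA).
Qed.

End expected_shortfall.

(** * Lower semicontinuity of the expected shortfall *)

Lemma limn_einf_ge (R : realType) (u : (\bar R)^nat) (a : \bar R) :
  (\forall n \near \oo, (a <= u n)%E) -> (a <= limn_einf u)%E.
Proof.
move=> [N _ Nu]; rewrite limn_einf_lim; apply: lime_ge; first exact: is_cvg_einfs.
exists N => // n /= Nn; apply: le_ereal_inf_tmp => _ [k /= nk <-].
by apply: Nu; exact: leq_trans nk.
Qed.

Lemma lt_limn_einf (R : realType) (u : (\bar R)^nat) (a : \bar R) :
  (a < limn_einf u)%E -> \forall n \near \oo, (a < u n)%E.
Proof.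
rewrite limn_einf_lim (cvg_lim _ (@cvg_einfs_sup _ u))// => /ereal_sup_gt[_ [N _ <-] aN].
exists N => // n /= Nn; apply: (lt_le_trans aN); apply: ereal_inf_lbound.
by exists n.
Qed.

Section lower_semicontinuity.
Context (d : measure_display) (T : measurableType d) (R : realType).
Variables (P : probability T R) (p : R).
Hypothesis p01 : 0 < p < 1.
Variables (X : Linfty P) (Y : nat -> Linfty P).
Hypothesis YX : forall w, Y n w @[n --> \oo] --> X w.

(** The hypothesis says that [X <= x] has probability below [s]. This event contains the upper limit
    of the events [Y n <= x], and the decreasing unions [E k] approach that upper limit in
    probability. *)
Lemma VaR_lsc (s x : R) : 0 < s < 1 -> x < VaR P s X ->
  \forall n \near \oo, x < VaR P s (Y n).
Proof.
move=> s01; rewrite ltNge VaR_le// -ltNge => Xs.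
pose E k := \bigcup_(n in [set n | (k <= n)%N]) (Y n @^-1` `]-oo, x]).
have mE k : measurable (E k) by apply: bigcup_measurable => n _; exact: measurable_funPTI.
have mEI : measurable (\bigcap_k E k) by exact: bigcapT_measurable.
have EX : \bigcap_k E k `<=` X @^-1` `]-oo, x].
  move=> w Ew /=; rewrite in_itv/= leNgt; apply/negP => xX.
  have [N _ NY] := cvgr_gt (X w) (@YX w) x xX.
  have [n /= Nn] := Ew N I; rewrite in_itv/= leNgt => /negP; apply.
  exact: NY.
have cE : P (E k) @[k --> \oo] --> P (\bigcap_k E k).
  apply: nonincreasing_cvg_mu => //.
    by rewrite (le_lt_trans (probability_le1 _ _))// ltry.
  move=> k l kl; apply/subsetPset => w [n /= ln Yn]; exists n => //=.
  exact: leq_trans ln.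
have : (P (\bigcap_k E k) < s%:E)%E.
  by apply: le_lt_trans Xs; apply: le_measure; rewrite ?inE//; exact: measurable_funPTI.
move=> /(@open_ereal_lt' _ _ _)/cE [N _ NE]; exists N => // n /= Nn.
rewrite ltNge VaR_le// -ltNge; apply: le_lt_trans (NE N (leqnn N)).
rewrite -[cdf _ x]/(P (Y n @^-1` `]-oo, x])).
apply: le_measure; rewrite ?inE; [exact: measurable_funPTI|exact: mE|].
by move=> w Yw; exists n.
Qed.

Lemma ES_lsc : ((ES P p X)%:E <= limn_einf (fun n => (ES P p (Y n))%:E))%E.
Proof.
have /andP[p0 p1] := p01.
have p1_gt0 : 0 < 1 - p by rewrite subr_gt0.
have bX (Z : Linfty P) : {M : R | \forall w \ae P, `|Z w| <= M}.
  by apply: cid; have [M _ ZM] := Linfty_bounded Z; exists M.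
pose q (Z : Linfty P) := quantile P Z (sval (bX Z)).
have qE Z s : 0 < s < 1 -> q Z s = VaR P s Z by exact: quantile_VaR.
have qnd Z : nondecreasing_fun (q Z) := nondecreasing_quantile (svalP (bX Z)).
(* Any level strictly below [VaR_p] of [X] would do: the [VaR_p] of [Y n] eventually exceeds it, and
   from then on the truncated integrand [g] is the quantile minus [m] above [p]. *)
pose m := VaR P p X - 1.
have [N _ NY] : \forall n \near \oo, m < VaR P p (Y n).
  by apply: VaR_lsc => //; rewrite /m; lra.
pose g Z s : R := Num.max (q Z s - m) 0.
have int_excess Z : (\int[lebesgue_measure]_(s in `]p, 1%R[) (g Z s)%:E)%E =
    (\int[lebesgue_measure]_(s in `]p, 1%R[) g Z s)%:E.
  rewrite /Rintegral fineK//; apply: integrable_fin_num => //.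
  exact: integrable_itv_excess (svalP (bX Z)) _ _ _ _ _.
have excessE (Z : Linfty P) : m <= VaR P p Z ->
    (\int[lebesgue_measure]_(s in `]p, 1%R[) (g Z s)%:E)%E =
    ((1 - p) * (ES P p Z - m))%:E.
  move=> mZ; rewrite int_excess (ES_shift_quantile (svalP (bX Z)) m p01).
  congr EFin; apply: eq_Rintegral => s; rewrite inE/= in_itv/= => /andP[ps s1].
  by apply/max_idPl; rewrite subr_ge0 (le_trans mZ)// -qE// qnd// ltW.
have mq Z : measurable_fun `]p, 1[ (fun s => (g Z s)%:E).
  exact: measurable_int (integrable_itv_excess (svalP (bX Z)) m p 1 false true).
have q0 Z s : (0 <= (g Z s)%:E)%E by rewrite lee_fin /g le_max lexx orbT.
have := @fatou _ _ _ lebesgue_measure `]p, 1[%classic (measurable_itv _)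
  (fun n s => (g (Y n) s)%:E) (fun n => mq (Y n)) (fun n s _ => q0 (Y n) s).
move=> fat.
(* Fatou's lemma reduces this to the lower semicontinuity of [VaR] at each single [s]. *)
have lo : (((1 - p) * (ES P p X - m))%:E <=
    limn_einf (fun n => \int[lebesgue_measure]_(s in `]p, 1%R[) (g (Y n) s)%:E))%E.
  apply: le_trans fat; rewrite -excessE; last by rewrite /m; lra.
  apply: ge0_le_integral => //.
  - exact: mq.
  - apply: measurableT_comp => //; apply: measurable_fun_limn_esup => n.
    by apply: measurableT_comp => //; exact: mq.
  - move=> s /=; rewrite in_itv/= => /andP[ps s1]; have s0 := lt_trans p0 ps.
    apply/lee_addgt0Pr => e e0; rewrite -leeBlDr// -EFinB.
    apply: limn_einf_ge.
    have : \forall n \near \oo, VaR P s X - e < VaR P s (Y n).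
      by apply: VaR_lsc; [rewrite s0|rewrite ltrBlDr ltrDl].
    apply: filterS => n; rewrite -!qE ?s0// => h.
    rewrite lee_fin /g le_max; case: (leP (q X s - m) 0) => [h0|h0].
      by apply/orP; right; rewrite sub0r oppr_le0 ltW.
    by apply/orP; left; move: h => /ltW; rewrite addrAC lerD2r.
apply/lee_subgt0Pr => e e0.
apply: limn_einf_ge.
have : \forall n \near \oo, (((1 - p) * (ES P p X - e - m))%:E <
    \int[lebesgue_measure]_(s in `]p, 1%R[) (g (Y n) s)%:E)%E.
  apply: lt_limn_einf; apply: lt_le_trans lo.
  by rewrite lte_fin ltr_pM2l// ltrD2r ltrBlDr ltrDl.
move=> [K _ NK]; exists (maxn N K) => // n /=; rewrite geq_max => /andP[Nn Kn].
have := NK n Kn; rewrite excessE; last exact/ltW/NY.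
by rewrite lte_fin ltr_pM2l// ltrD2r -EFinB lee_fin => /ltW.
Qed.

End lower_semicontinuity.

(** * Tail events *)

Section tail_event_existence.
Context (d : measure_display) (T : measurableType d) (R : realType).
Variable P : probability T R.
Variable U : {RV P >-> R}.
Hypothesis U01 : forall w, 0 < U w < 1.
Hypothesis cdfU : forall x : R, 0 <= x <= 1 -> cdf U x = x%:E.

Lemma measurable_uniform_le (x : R) : measurable [set w | U w <= x].
Proof. by have := @measurable_funPTI _ _ _ _ U `]-oo, x]%classic; apply. Qed.

Lemma measurable_uniform_itv (a b : R) : measurable [set w | a < U w <= b].
Proof. by have := @measurable_funPTI _ _ _ _ U `]a, b]%classic; apply. Qed.

Lemma uniform_itv (a b : R) : 0 <= a -> a <= b -> b <= 1 ->
  P [set w | a < U w <= b] = (b - a)%:E.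
Proof.
move=> a0 ab b1.
have -> : [set w | a < U w <= b] = [set w | U w <= b] `\` [set w | U w <= a].
  apply/seteqP; split => w /=; first by move=> /andP[aU ->]; rewrite leNgt aU.
  by move=> [-> /negP]; rewrite -ltNge => ->.
rewrite measureD ?(le_lt_trans (probability_le1 _ _)) ?ltry//;
  do ?exact: measurable_uniform_le.
rewrite setIidr; last by move=> w /= /le_trans; apply.
transitivity (cdf U b - cdf U a)%E; first by [].
by rewrite !cdfU// ?a0 ?b1 ?(le_trans ab) ?(le_trans a0)//= -EFinB.
Qed.

Lemma uniform_itv_le (a b : R) : a <= b -> (P [set w | (a < U w <= b)%R] <= (b - a)%:E)%E.
Proof.
(* The endpoints are clamped to the unit interval, where [U] takes its values; the outer maximum
   keeps them in order. *)
move=> ab; pose a' := Num.max a 0; pose b' := Num.max a' (Num.min b 1).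
have [a1|a1] := leP a' 1; last first.
  rewrite (_ : [set _ | _] = set0) ?measure0 ?lee_fin ?subr_ge0//.
  apply/seteqP; split => // w /= /andP[aU _]; have /andP[U0 U1] := U01 w.
  by move: a1; rewrite ltNge => /negP; apply; rewrite ge_max !ltW// (lt_trans aU).
have a'0 : 0 <= a' by rewrite le_max lexx orbT.
have a'b' : a' <= b' by rewrite le_max lexx.
have b'1 : b' <= 1 by rewrite ge_max a1 ge_min lexx orbT.
apply: (@le_trans _ _ (b' - a')%:E).
  rewrite -uniform_itv//; apply: le_measure; rewrite ?inE; do ?exact: measurable_uniform_itv.
  move=> w /= /andP[aU Ub]; have /andP[U0 U1] := U01 w.
  by rewrite gt_max aU U0/= le_max le_min Ub (ltW U1) orbT.
rewrite lee_fin lerBlDr ge_max ge_min; apply/andP; split.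
  by rewrite -[leLHS]add0r lerD2r subr_ge0.
apply/orP; left; rewrite -[leLHS]addr0 -addrA lerD2l addrC subr_ge0.
by rewrite le_max lexx.
Qed.

Variable p : R.
Hypothesis p01 : 0 < p < 1.

(** With [v] the value at risk, [v < X] has probability at most [1 - p] and [v <= X] at least
    [1 - p]. A possible atom at [v] is split by [U]: the probability of [A c] is 1-Lipschitz in [c],
    so some [c] gives exactly [1 - p]. *)
Lemma tail_event_exists (X : Linfty P) : exists A, p_tail_event P p X A.
Proof.
pose v := VaR P p X.
have mX : measurable_fun setT X by exact: measurable_funP.
have mle : measurable [set w | X w <= v].
  by rewrite -[X in measurable X]setTI; apply: measurable_fun_le.
have gtE : [set w | v < X w] = ~` [set w | X w <= v].
  by apply/seteqP; split => w /=; rewrite ltNge => /negP.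
have mgt : measurable [set w | v < X w] by rewrite gtE; exact: measurableC.
have mge : measurable [set w | v <= X w].
  by rewrite -[X in measurable X]setTI; apply: measurable_fun_le.
have meq : measurable [set w | X w = v].
  by have := @measurable_funPTI _ _ _ _ X [set v]; apply.
pose A c := [set w | v < X w] `|` ([set w | X w = v] `&` [set w | U w <= c]).
have mA c : measurable (A c).
  by apply: measurableU => //; apply: measurableI => //; exact: measurable_uniform_le.
have fA c : P (A c) \is a fin_num by rewrite fin_num_measure.
pose g c := fine (P (A c)).
have gE c : P (A c) = (g c)%:E by rewrite fineK.
have gle a b : a <= b -> g a <= g b <= g a + (b - a).
  move=> ab; rewrite -!lee_fin EFinD -!gE; apply/andP; split.
    apply: le_measure; rewrite ?inE//; apply: setUS; apply: setIS => w /= /le_trans; exact.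
  apply: (@le_trans _ _ (P (A a `|` [set w | a < U w <= b]))).
    apply: le_measure; rewrite ?inE//.
      by apply: measurableU => //; exact: measurable_uniform_itv.
    move=> w [h|[h /= Ub]]; first by left; left.
    by have [Ua|Ua] := leP (U w) a; [left; right|right; apply/andP].
  apply: le_trans (measureU2 _ _ _) _ => //; first exact: measurable_uniform_itv.
  by rewrite leeD2l// uniform_itv_le.
have gcont : continuous g.
  move=> c; apply/cvgrPdist_lt => e e0; near=> y.
  have yc : `|c - y| < e by near: y; apply: cvgr_dist_lt => //; exact: cvg_id.
  apply: le_lt_trans yc.
  have [cy|/ltW yc] := leP c y.
    by have /andP[h1 h2] := gle _ _ cy; rewrite !ler0_norm ?subr_le0//; lra.
  by have /andP[h1 h2] := gle _ _ yc; rewrite !ger0_norm ?subr_ge0//; lra.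
have /andP[p0 p1] := p01.
have Pcompl (B : set T) : measurable B -> P (~` B) = (1 - fine (P B))%:E.
  by move=> mB; rewrite probability_setC// EFinB fineK// fin_num_measure.
have g0 : g 0 <= 1 - p.
  rewrite -lee_fin -gE (_ : A 0 = ~` [set w | X w <= v]); last first.
    rewrite -gtE; apply/seteqP; split => w; last by left.
    by case=> // -[_ /=]; rewrite leNgt (andP (U01 w)).1.
  rewrite Pcompl// lee_fin lerD2l lerN2 -lee_fin fineK ?fin_num_measure//.
  by rewrite -[leRHS]/(cdf X v) -VaR_le.
have g1 : 1 - p <= g 1.
  rewrite -lee_fin -gE; pose B := [set w | X w < v].
  have mB : measurable B.
    rewrite (_ : B = ~` [set w | v <= X w]); first exact: measurableC.
    by apply/seteqP; split => w /=; rewrite /B/= ltNge => /negP.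
  have AB : ~` B `<=` A 1.
    move=> w /negP; rewrite -leNgt le_eqVlt => /predU1P[vX|vX]; last by left.
    by right; split => //=; rewrite ltW// (andP (U01 w)).2.
  apply: (@le_trans _ _ (P (~` B))); last first.
    by apply: le_measure; rewrite ?inE//; exact: measurableC.
  rewrite Pcompl// lee_fin lerD2l lerN2 -lee_fin fineK ?fin_num_measure//.
  (* The event [X < v] is approached from below by events of probability less than [p], by
     minimality of [v]. *)
  pose C n := X @^-1` `]-oo, v - n.+1%:R^-1].
  have mC n : measurable (C n) by exact: measurable_funPTI.
  have BC : B = \bigcup_n C n.
    apply/seteqP; split => [w /= Xv|w [n _]]; last first.
      rewrite /C/B/= in_itv/= => /le_lt_trans; apply.
      by rewrite ltrBlDr ltrDl invr_gt0.
    have : 0 < v - X w by rewrite subr_gt0.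
    move=> /ltr_add_invr[n]; rewrite add0r => h; exists n => //.
    by rewrite /C/= in_itv/= lerBrDr -lerBrDl ltW.
  have cC : P (C n) @[n --> \oo] --> P B.
    rewrite BC; apply: nondecreasing_cvg_mu => //; first by rewrite -BC.
    move=> n m nm; apply/subsetPset => w; rewrite /C/= !in_itv/= => /le_trans; apply.
    by rewrite lerB// lef_pV2 ?posrE// ler_nat.
  rewrite -(cvg_lim _ cC)//; apply: lime_le; first by apply/cvg_ex; exists (P B).
  apply: nearW => n; rewrite -[P (C n)]/(cdf X (v - n.+1%:R^-1)) leNgt; apply/negP => h.
  have : VaR P p X <= v - n.+1%:R^-1 by rewrite VaR_le// ltW.
  by rewrite -/v leNgt ltrBlDr ltrDl invr_gt0 ltr0n.
have [||c _ gc] := @IVT R g 0 1 (1 - p) ler01.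
- exact: continuous_subspaceT.
- by rewrite ge_min g0 le_max g1 orbT.
exists (A c); split; last by rewrite gE gc.
split => //.
- by rewrite gE gc lte_fin subr_gt0.
- by rewrite gE gc lte_fin ltrBlDr ltrDl.
- apply: nearW => w Aw; apply: nearW => w' Aw'.
  have vX : v <= X w by case: Aw => [/ltW//|[<-]].
  apply: le_trans vX; rewrite leNgt; apply/negP => vX'.
  by apply: Aw'; left.
Unshelve. all: by end_near. Qed.

End tail_event_existence.

(** * Concentration aversion and averaging of step variables *)

Section concentration_averse.
Context (d : measure_display) (T : measurableType d) (R : realType).
Variables (P : probability T R) (p : R) (rho : Linfty P -> R).
Hypothesis p01 : 0 < p < 1.
Hypothesis rho_ca : p_concentration_averse p rho.

Lemma tail_event_cst (X : Linfty P) (c : R) A : measurable A -> P A = (1 - p)%:E ->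
  (forall w, X w = c) -> p_tail_event P p X A.
Proof.
move=> mA PA Xc; have /andP[p0 p1] := p01; split => //; split => //.
- by rewrite PA lte_fin subr_gt0.
- by rewrite PA lte_fin ltrBlDr ltrDl.
- apply: nearW => w _; apply: nearW => w' _.
  have h : X w' <= X w by rewrite !Xc.
  exact: h.
Qed.

(** Concentration aversion is applied with 0 as second summand; [A] is a tail event of this constant
    too. *)
Lemma le_rho_law (X Y : Linfty P) A : p_tail_event P p Y A -> eq_law P X Y ->
  rho X <= rho Y.
Proof.
move=> tY XY; rewrite -[X]addr0 -[Y]addr0; apply: rho_ca => //.
exists A; split => //; have [[mA _ _ _] PA] := tY.
by apply: (tail_event_cst (c := 0)).
Qed.

(** Both pairs are concentrated on [A], so concentration aversion applies in both directions. *)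
Lemma rho_exchange (X Y Z : Linfty P) A : p_tail_event P p X A ->
  p_tail_event P p Y A -> p_tail_event P p Z A -> eq_law P X Y ->
  rho (X + Z) = rho (Y + Z).
Proof.
move=> tX tY tZ XY; apply/eqP; rewrite eq_le; apply/andP; split; apply: rho_ca => //.
- by exists A.
- by exists A.
- by move=> B mB; rewrite XY.
Qed.

End concentration_averse.

(** * Step variables and cyclic shifts of their values *)

Section step_variables.
Context (d : measure_display) (T : measurableType d) (R : realType).
Variables (P : probability T R) (p : R) (n : nat) (L : T -> bool * 'I_n.+1).
Hypothesis p01 : 0 < p < 1.
Hypothesis mL : forall l, measurable [set w | L w = l].
Variable mass : bool -> R.
Hypothesis PL : forall l, P [set w | L w = l] = (mass l.1)%:E.
Hypothesis PL1 : P [set w | (L w).1] = (1 - p)%:E.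
Implicit Type f : bool -> 'I_n.+1 -> R.

Lemma preimage_step f (B : set R) : [set w | B (f (L w).1 (L w).2)] =
  \bigcup_(l in [set l | B (f l.1 l.2)]) [set w | L w = l].
Proof.
apply/seteqP; split => [w Bw|w [l Bl /= wl]]; first by exists (L w).
by rewrite wl.
Qed.

Lemma measurable_step f : measurable_fun setT (fun w => f (L w).1 (L w).2).
Proof.
move=> _ B mB; rewrite setTI.
suff : measurable [set w | B (f (L w).1 (L w).2)] by [].
by rewrite (preimage_step f B); apply: fin_bigcup_measurable.
Qed.

Lemma bounded_step f w : `|f (L w).1 (L w).2| <= \sum_l `|f l.1 l.2|.
Proof. by rewrite (bigD1 (L w))//= lerDl sumr_ge0. Qed.

(** Labels with first component [true] partition the tail event, those with [false] its complement;
    the probability of a label depends on its side only. *)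
Definition step f : Linfty P :=
  Lfun_Sub (leey 1%E) (bounded_Linfty P (measurable_step f) (bounded_step f)).

Lemma stepE f w : step f w = f (L w).1 (L w).2. Proof. by []. Qed.

Lemma stepD f g : step (fun b i => f b i + g b i) = step f + step g.
Proof. by apply/LfuneqP => w; rewrite LinftyD !stepE. Qed.

Lemma distribution_step f (B : set R) : distribution P (step f) B =
  (\sum_(l \in [set l | B (f l.1 l.2)]) (mass l.1)%:E)%E.
Proof.
transitivity (P [set w | B (f (L w).1 (L w).2)]); first by [].
rewrite (preimage_step f B) measure_fin_bigcup//.
- by apply: eq_fsbigr => l _; exact: PL.
- exact: finite_finset.
- by move=> l l' _ _ [w [/= <- <-]].
Qed.

(** Addition on ['I_n.+1] is modulo [n.+1], so this permutes the values within each side and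
    preserves the law. *)
Definition cyclic_shift (j : 'I_n.+1) f b i := f b (i + j).

Lemma eq_law_shift f j : eq_law P (step f) (step (cyclic_shift j f)).
Proof.
move=> B mB; rewrite !distribution_step.
pose h (l : bool * 'I_n.+1) := (l.1, l.2 + j).
rewrite (reindex_fsbig h [set l | B (cyclic_shift j f l.1 l.2)])//.
split => [l //|l l' _ _|[b i] /= Bi].
  move=> e; have /= e1 := congr1 fst e; have /= /addIr e2 := congr1 snd e.
  by case: l l' e1 e2 {e} => ? ? [? ?] /= -> ->.
by exists (b, i - j); rewrite /h/= /cyclic_shift ?subrK.
Qed.

(** All such steps share the tail event of labels on the side [true]; shifts, sums and nonnegative
    multiples stay in this class. *)
Definition ordered_step f := forall i j, f false i <= f true j.

Lemma p_tail_step f : ordered_step f -> p_tail_event P p (step f) [set w | (L w).1].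
Proof.
move=> fo; have /andP[p0 p1] := p01; split => //; split => //.
- rewrite (_ : [set _ | _] = \bigcup_(l in [set l : bool * 'I_n.+1 | l.1]) [set w | L w = l]).
    by apply: fin_bigcup_measurable => //; exact: finite_finset.
  by apply/seteqP; split => [w Lw|w [l ? /= ->]//]; exists (L w).
- by rewrite PL1 lte_fin subr_gt0.
- by rewrite PL1 lte_fin ltrBlDr ltrDl.
- apply: nearW => w Lw; apply: nearW => w' Lw'.
  have h : step f w' <= step f w.
    by rewrite !stepE Lw; move/negP/negbTE : Lw' => ->; exact: fo.
  exact: h.
Qed.

Variable rho : Linfty P -> R.
Hypothesis rho_ca : p_concentration_averse p rho.

(** The step is a sum of [n.+1] copies of [cf]. Exchanging the copies one at a time for the
    different cyclic shifts leaves [rho] unchanged, and the sum of all shifts is constant on each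
    side. *)
Lemma rho_step_mean f : ordered_step f ->
  rho (step f) = rho (step (fun b _ => n.+1%:R^-1 * \sum_j f b j)).
Proof.
move=> fo; pose c : R := n.+1%:R^-1.
have c0 : 0 <= c by rewrite invr_ge0.
pose cf b i := c * f b i.
(* Here [k] copies are already shifted, by 0 up to [k - 1], and [m] copies remain unshifted. *)
pose S k (m : R) b (i : 'I_n.+1) := \sum_(j < k) cf b (i + inord j) + m * cf b i.
have ocf j : ordered_step (cyclic_shift j cf).
  by move=> i i'; rewrite /cyclic_shift/cf ler_wpM2l.
have oS k m : 0 <= m -> ordered_step (S k m).
  move=> m0 i i'; rewrite /S lerD ?ler_sum//; last by rewrite ler_wpM2l// ler_wpM2l.
  by move=> j _; rewrite ler_wpM2l.
have invariant k : (k <= n.+1)%N -> rho (step f) = rho (step (S k (n.+1 - k)%:R)).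
  elim: k => [|k ih] kn.
    congr (rho (step _)); apply/funext => b; apply/funext => i.
    by rewrite /S big_ord0 add0r subn0 /cf mulrA mulfV ?mul1r// pnatr_eq0.
  rewrite ih ?(ltnW kn)//; set m : R := (n.+1 - k.+1)%:R.
  have mE : (n.+1 - k)%:R = 1 + m by rewrite nat1r subnSK.
  (* One unshifted copy is split off, to be exchanged for the shift by [k]. *)
  have -> : step (S k (n.+1 - k)%:R) = step (cyclic_shift 0 cf) + step (S k m).
    rewrite -stepD; congr step; apply/funext => b; apply/funext => i.
    by rewrite /S /cyclic_shift addr0 mE mulrDl mul1r addrCA.
  have -> : step (S k.+1 m) = step (cyclic_shift (inord k) cf) + step (S k m).
    rewrite -stepD; congr step; apply/funext => b; apply/funext => i.
    by rewrite /S /cyclic_shift big_ord_recr/= addrAC addrC.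
  apply: (rho_exchange rho_ca).
  - by apply: p_tail_step; exact: ocf.
  - by apply: p_tail_step; exact: ocf.
  - by apply: p_tail_step; apply: oS.
  - have -> : cyclic_shift (inord k) cf = cyclic_shift (inord k) (cyclic_shift 0 cf).
      by apply/funext => b; apply/funext => i; rewrite /cyclic_shift addr0.
    exact: eq_law_shift.
rewrite (invariant n.+1)//; congr (rho (step _)); apply/funext => b; apply/funext => i.
rewrite /S subnn mul0r addr0 -mulr_sumr; congr (_ * _).
rewrite (eq_bigr (fun j : 'I_n.+1 => f b (i + j))) => [|j _]; last by rewrite inord_val.
by rewrite [RHS](reindex_inj (addrI i)).
Qed.

Lemma rho_step_cst (rho_ti : translation_invariant rho) (a b : R) :
  rho (step (fun c _ => if c then a else b)) =
  a + rho (step (fun c _ => if c then 0 else b - a)).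
Proof.
rewrite addrC -rho_ti; congr rho; apply/LfuneqP => w.
by rewrite LinftyD !stepE/=; case: ifP => _; rewrite ?add0r// subrK.
Qed.

End step_variables.

(** * Uniqueness *)

Section uniform_labels.
Context (d : measure_display) (T : measurableType d) (R : realType).
Variable P : probability T R.
Variable U : {RV P >-> R}.
Hypothesis U01 : forall w, 0 < U w < 1.
Hypothesis cdfU : forall x : R, 0 <= x <= 1 -> cdf U x = x%:E.
Variable p : R.
Hypothesis p01 : 0 < p < 1.
Variable n : nat.

(** These points cut the interval from 0 to [p] (side [false]) and the one from [p] to 1 (side
    [true]) into [n.+1] equal parts. *)
Definition knot (b : bool) (k : nat) : R :=
  if b then p + (1 - p) * (k%:R / n.+1%:R) else p * (k%:R / n.+1%:R).

Let p0 : 0 < p. Proof. by case/andP : p01. Qed.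
Let q0 : 0 < 1 - p. Proof. by rewrite subr_gt0; case/andP : p01. Qed.

Lemma knot0 b : knot b 0 = if b then p else 0.
Proof. by rewrite /knot mul0r !mulr0 addr0. Qed.

Lemma knot_last b : knot b n.+1 = if b then 1 else p.
Proof. by rewrite /knot divff ?pnatr_eq0// !mulr1 subrKC. Qed.

Lemma knot_lt b k m : (knot b k < knot b m) = (k < m)%N.
Proof.
by rewrite /knot; case: b; rewrite ?ltrD2l ltr_pM2l// ltr_pM2r ?invr_gt0// ltr_nat.
Qed.

Lemma knot_le b k m : (knot b k <= knot b m) = (k <= m)%N.
Proof. by rewrite leNgt knot_lt -leqNgt. Qed.

Lemma knotS b k : knot b k.+1 - knot b k = (if b then 1 - p else p) / n.+1%:R.
Proof. by rewrite /knot -natr1; case: b; ring. Qed.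

Lemma label_exists u : 0 < u < 1 -> exists l : bool * 'I_n.+1,
  knot l.1 l.2 < u <= knot l.1 l.2.+1.
Proof.
move=> /andP[u0 u1].
have ex : exists m, u <= knot (p < u) m.
  by exists n.+1; rewrite knot_last; case: ltP => // _; exact: ltW.
(* The least knot at or above [u] is the right end of its interval, so the label index is the
   predecessor; index 0 is excluded since [u] lies strictly above the first knot of its side. *)
case: (ex_minnP ex) => -[|m] um min.
  by move: um; rewrite knot0; case: ltP => // pu; rewrite leNgt ?pu ?u0.
have mn : (m < n.+1)%N.
  by apply: min; rewrite knot_last; case: ltP => // _; exact: ltW.
exists (p < u, Ordinal mn); rewrite /= um andbT ltNge; apply/negP => /min.
by rewrite ltnn.
Qed.

Definition label w := sval (cid (label_exists (U01 w))).

Lemma label_knot w : knot (label w).1 (label w).2 < U w <= knot (label w).1 (label w).2.+1.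
Proof. exact: (svalP (cid (label_exists (U01 w)))). Qed.

Lemma knot_side b (i : 'I_n.+1) u : knot b i < u <= knot b i.+1 -> b = (p < u).
Proof.
case: b => /andP[iu ui]; apply/esym; last first.
  apply/negbTE; rewrite -leNgt (le_trans ui)// -[leRHS](knot_last false).
  by rewrite knot_le ltn_ord.
by apply: le_lt_trans iu; rewrite -[leLHS](knot0 true) knot_le.
Qed.

Lemma label_side w : (label w).1 = (p < U w).
Proof. exact: knot_side (label_knot w). Qed.

(** The chosen label is the only possible one: comparison with [p] determines the side, and strict
    monotonicity of the knots determines the index. *)
Lemma label_fiber l : [set w | label w = l] =
  [set w | knot l.1 l.2 < U w <= knot l.1 l.2.+1].
Proof.
apply/seteqP; split => w /=; first by move=> <-; exact: label_knot.
move=> lw; have e1 : (label w).1 = l.1 by rewrite label_side -(knot_side lw).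
have := label_knot w; rewrite e1; case/andP: lw => li il /andP[ki ik].
have e2 : (label w).2 = l.2.
  apply/val_inj/eqP; rewrite eqn_leq; apply/andP; split.
    by rewrite -ltnS -(knot_lt l.1) (lt_le_trans ki il).
  by rewrite -ltnS -(knot_lt l.1) (lt_le_trans li ik).
by case: (label w) l e1 e2 {li il ki ik} => ? ? [? ?] /= -> ->.
Qed.

Lemma measurable_label l : measurable [set w | label w = l].
Proof. by rewrite label_fiber; exact: measurable_uniform_itv. Qed.

Definition label_mass (b : bool) : R := (if b then 1 - p else p) / n.+1%:R.

Lemma probability_label l : P [set w | label w = l] = (label_mass l.1)%:E.
Proof.
rewrite label_fiber (uniform_itv cdfU) ?knotS//.
- apply: (@le_trans _ _ (knot l.1 0)); last by rewrite knot_le.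
  by rewrite knot0; case: ifP => // _; exact: ltW.
- by rewrite knot_le.
- apply: (@le_trans _ _ (knot l.1 n.+1)); first by rewrite knot_le ltn_ord.
  by rewrite knot_last; case: ifP => // _; rewrite ltW//; case/andP : p01.
Qed.

Lemma probability_label_upper : P [set w | (label w).1] = (1 - p)%:E.
Proof.
rewrite (_ : [set _ | _] = [set w | p < U w <= 1]).
  have /andP[_ p1] := p01.
  by rewrite (uniform_itv cdfU) ?(ltW p0) ?(ltW p1).
apply/seteqP; split => w /=; rewrite label_side; last by case/andP.
by move=> ->; rewrite ltW//; case/andP: (U01 w).
Qed.

End uniform_labels.

(** * Bounds on the risk measure by sums of quantiles *)

Section representation.
Context (d : measure_display) (T : measurableType d) (R : realType).
Variable P : probability T R.
Variable U : {RV P >-> R}.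
Hypothesis U01 : forall w, 0 < U w < 1.
Hypothesis cdfU : forall x : R, 0 <= x <= 1 -> cdf U x = x%:E.
Variable p : R.
Hypothesis p01 : 0 < p < 1.

Let ustep n (f : bool -> 'I_n.+1 -> R) : Linfty P :=
  step P (measurable_label U01 p01 (n := n)) f.

Variable rho : Linfty P -> R.
Hypotheses (rho_mono : monotone_risk rho) (rho_ti : translation_invariant rho)
  (rho_lsc : pointwise_lsc rho) (rho_ca : p_concentration_averse p rho) (rho0 : rho 0 = 0).

(** A single label per side gives one variable that serves for every [n], as [ustep_const] shows. *)
Let two (a b : R) := @ustep 0 (fun c _ => if c then a else b).

Lemma ustep_const n (a b : R) : @ustep n (fun c _ => if c then a else b) = two a b.
Proof. by apply/LfuneqP => w; rewrite !stepE !label_side. Qed.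

Lemma rho_ustep_mean n f : @ordered_step R n f -> rho (ustep f) =
  rho (two (n.+1%:R^-1 * \sum_j f true j) (n.+1%:R^-1 * \sum_j f false j)).
Proof.
move=> fo; rewrite -(ustep_const n).
rewrite /ustep (@rho_step_mean _ _ _ _ _ _ (label U01 p n) p01 _ (label_mass p n)
  (@probability_label _ _ _ _ _ U01 cdfU _ p01 n)
  (probability_label_upper U01 cdfU p01 n) _ rho_ca _ fo).
by congr (rho (step _ _ _)); apply/funext => -[].
Qed.

(* The steps [- t (n + 1)] on [{0 < U <= p / (n + 1)}] converge pointwise to 0, but
   averaging over [{U <= p}] sends all of them to the same step [- t]; lower
   semicontinuity then forces its value to be that of 0. *)
Lemma rho_lower_tail (t : R) : 0 <= t -> rho (two 0 (- t)) = 0.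
Proof.
move=> t0; apply/eqP; rewrite eq_le; apply/andP; split.
  rewrite -[leRHS]rho0; apply: rho_mono => w; rewrite stepE/=.
  by case: ifP => _ //; rewrite oppr_le0.
pose f n (c : bool) (i : 'I_n.+1) : R :=
  if c then 0 else if i == ord0 then - t * n.+1%:R else 0.
have fo n : ordered_step (f n).
  move=> i j; rewrite /f; case: ifP => // _.
  by rewrite mulNr oppr_le0 mulr_ge0.
have rhof n : rho (ustep (f n)) = rho (two 0 (- t)).
  rewrite rho_ustep_mean//; congr (rho (two _ _)).
    by rewrite big1 ?mulr0.
  rewrite (bigD1 ord0)//= big1 => [|i /negbTE]; last by rewrite /f => ->.
  by rewrite addr0 mulrCA mulVf ?mulr1// pnatr_eq0.
have cv w : ustep (f n) w @[n --> \oo] --> (0 : Linfty P) w.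
  have /andP[U0 U1] := U01 w.
  have [N] := ltr_add_invr U0; rewrite add0r => NU.
  apply: cvg_near_cst; exists N => // n /= Nn.
  transitivity (f n (label U01 p n w).1 (label U01 p n w).2); first by [].
  rewrite /f.
  case: ifP => // side; case: ifP => // /eqP lab0.
  have := label_knot U01 p n w; rewrite side lab0 => /andP[_].
  rewrite leNgt /knot => /negP[]; apply: le_lt_trans NU.
  rewrite mul1r; apply: (@le_trans _ _ n.+1%:R^-1).
    by rewrite ler_piMl ?invr_ge0// ltW//; case/andP : p01.
  by rewrite lef_pV2 ?posrE// ler_nat.
have := rho_lsc cv; rewrite rho0 leNgt => h; rewrite leNgt; apply/negP => r0.
(* The sequence is constant with value [r]; if [r < 0], a lower limit at least 0 would give
   [r / 2 < r]. *)
have [N _ /(_ N (leqnn N))] : \forall n \near \oo,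
    ((rho (two 0 (- t)) / 2)%:E < (rho (ustep (f n)))%:E)%E.
  apply: lt_limn_einf; rewrite ltNge; apply/negP => h'; move/negP : h; apply.
  by apply: (le_lt_trans h'); rewrite lte_fin; lra.
by rewrite /= rhof lte_fin; lra.
Qed.

Lemma rho_two (a b : R) : b <= a -> rho (two a b) = a.
Proof.
move=> ba; rewrite rho_step_cst// -[b - a]opprB.
by rewrite [X in _ + X]rho_lower_tail ?addr0// subr_ge0.
Qed.

Lemma rho_ordered_step n f : @ordered_step R n f ->
  rho (ustep f) = n.+1%:R^-1 * \sum_j f true j.
Proof.
move=> fo; rewrite rho_ustep_mean// rho_two// ler_wpM2l ?invr_ge0//.
by apply: ler_sum => j _; exact: fo.
Qed.

Variables (X : Linfty P) (M : R).
Hypothesis XM : \forall w \ae P, `|X w| <= M.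
Let q := quantile P X M.

Lemma measurable_quantile_uniform : measurable_fun setT (fun w => q (U w)).
Proof.
have mq : measurable_fun [set: R] q by exact: measurable_quantile XM.
by apply: measurableT_comp => //; exact: measurable_funP.
Qed.

Let W : Linfty P := Lfun_Sub (leey 1%E)
  (bounded_Linfty P measurable_quantile_uniform (fun w => quantile_bound XM (U w))).

(** Since [U] stays inside the open unit interval, [q (U w) <= x] holds exactly when [U w] is at
    most the distribution function of [X] at [x]. *)
Lemma eq_law_quantile_uniform : eq_law P X W.
Proof.
move=> B mB; apply: (cdf_distribution _ mB) => x.
have fc := @cdf_fin_num _ _ _ P X x.
have -> : @cdf _ _ _ P X x = @cdf _ _ _ P U (fine (@cdf _ _ _ P X x)).
  by rewrite cdfU ?fineK// fine_ge0 ?cdf_ge0//= -lee_fin fineK// cdf_le1.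
have qU w : (q (U w) <= x) = (U w <= fine (@cdf _ _ _ P X x)).
  by rewrite /q (quantile_le (P := P))// -lee_fin fineK.
congr (P _); apply/seteqP; split => w; rewrite /= !in_itv/=.
  by rewrite -qU.
by move=> Wx; rewrite -qU.
Qed.

(** Each inequality uses a tail event of its right-hand variable, supplied by
    [tail_event_exists]. *)
Lemma rho_quantile_uniform : rho X = rho W.
Proof.
have [A tX] := tail_event_exists U01 cdfU p01 X.
have [B tW] := tail_event_exists U01 cdfU p01 W.
apply/eqP; rewrite eq_le; apply/andP; split.
  exact: (le_rho_law p01 rho_ca tW (@eq_law_quantile_uniform)).
apply: (le_rho_law p01 rho_ca tX) => C mC.
by rewrite eq_law_quantile_uniform.
Qed.

(** On each label interval [q (U w)] lies between the values of [q] at the two end knots. Both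
    bounds are ordered steps, of which [rho] only retains the mean over the upper side. *)
Lemma rho_between n :
  n.+1%:R^-1 * \sum_(j < n.+1) q (knot p n true j) <= rho X <=
  n.+1%:R^-1 * \sum_(j < n.+1) q (knot p n true j.+1).
Proof.
have qnd := nondecreasing_quantile XM.
have ok k m : (k <= n.+1)%N -> knot p n false k <= knot p n true m.
  move=> kn; apply: (@le_trans _ _ (knot p n false n.+1)); first by rewrite knot_le.
  by rewrite knot_last -[leLHS](knot0 p n true) knot_le.
rewrite -!(rho_ordered_step (f := fun b (j : 'I_n.+1) => q (knot p n b _))); first last.
- by move=> i j; apply/qnd/ok; exact: ltnW.
- by move=> i j; apply/qnd/ok.
rewrite rho_quantile_uniform; apply/andP; split; apply: rho_mono => w.
  by rewrite stepE; apply: qnd; have /andP[/ltW] := label_knot U01 p n w.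
by rewrite stepE; apply: qnd; have /andP[] := label_knot U01 p n w.
Qed.

End representation.

Theorem theorem4 (d : measure_display) (T : measurableType d) (R : realType)
    (P : probability T R) (hP : atomless P) (p : R) (hp0 : 0 < p) (hp1 : p < 1)
    (rho : Linfty P -> R) :
  [/\ monotone_risk rho, translation_invariant rho, pointwise_lsc rho,
      p_concentration_averse p rho & rho 0 = 0] <->
  (forall X : Linfty P, rho X = ES P p X).
Proof.
have p01 : 0 < p < 1 by rewrite hp0.
(* The expected shortfall satisfies the same axioms, so [rho_between] also applies to it and puts
   both quantities between the same two sums. *)
pose es (X : Linfty P) := ES P p X.
have es_mono : monotone_risk es := @le_ES _ _ _ P p p01.
have es_ti : translation_invariant es := ES_translation p01.
have es_lsc : pointwise_lsc es by move=> X Xn XnX; exact: ES_lsc.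
have es_ca : p_concentration_averse p es := ES_concentration_averse p01.
have es0 : es 0 = 0 := ES0 P p01.
split=> [[mono ti lsc ca rho0] X|rhoE]; last first.
  by have -> : rho = es by apply/funext.
have [U U01 cdfU] := uniform_variable_exists hP.
have [M M0 XM] := Linfty_bounded X.
have between n := rho_between U01 cdfU p01 mono ti lsc ca rho0 XM n.
have es_between n := rho_between U01 cdfU p01 es_mono es_ti es_lsc es_ca es0 XM n.
(* The difference of the two sums telescopes to two values of the quantile function, each bounded by
   [M]. *)
have gap n : n.+1%:R^-1 * \sum_(j < n.+1) quantile P X M (knot p n true j.+1) <=
    n.+1%:R^-1 * \sum_(j < n.+1) quantile P X M (knot p n true j) + n.+1%:R^-1 * (2 * M).
  rewrite -mulrDr ler_wpM2l ?invr_ge0// -lerBlDl -sumrB.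
  rewrite -(big_mkord xpredT (fun j => quantile P X M (knot p n true j.+1) -
    quantile P X M (knot p n true j))).
  rewrite (telescope_sumr (fun j => quantile P X M (knot p n true j)))// mulr_natl mulr2n.
  have qb := quantile_bound XM.
  apply: le_trans (ler_norm _) _; apply: le_trans (ler_normB _ _) _.
  by rewrite lerD.
have close e : 0 < e -> exists n, n.+1%:R^-1 * (2 * M) <= e.
  (* The added 1 keeps the divisor positive when [M] is 0. *)
  move=> e0; have M1 : 0 < 2 * M + 1 by rewrite ltr_wpDl// mulr_ge0.
  have /ltr_add_invr[n] : 0 < e / (2 * M + 1) by rewrite divr_gt0.
  rewrite add0r ltr_pdivlMr// => h; exists n; apply: le_trans (ltW h).
  by rewrite ler_wpM2l ?invr_ge0// lerDl.
apply/eqP; rewrite eq_le; apply/andP; split; apply/ler_addgt0Pr => e /close[n en].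
- have /andP[_ h1] := between n; have /andP[h2 _] := es_between n.
  by apply: (le_trans h1); apply: (le_trans (gap n)); rewrite lerD.
- have /andP[_ h1] := es_between n; have /andP[h2 _] := between n.
  by apply: (le_trans h1); apply: (le_trans (gap n)); rewrite lerD.
Qed.
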